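(* Let $s\in\mathbb R$ and $p,q\in(0,+\infty]$. If the wavelet system $\{\psi^{(i)}_{j,k}\}$ satisfies the dyadic covering property, then the set of sequences of $b^{s,q}_p$ whose wavelet series is maximally divergent in $\mathbb R^d$ is residual in $b^{s,q}_p$, i.e. contains a countable intersection of dense open subsets of $b^{s,q}_p$.
   Context: Setting: integers $d,N\ge1$, bounded fast-decaying $\psi^{(1)},\dots,\psi^{(N)}:\mathbb R^d\to\mathbb C$, wavelets $\psi^{(i)}_{j,k}(x)=\psi^{(i)}(2^jx-k)$, $j\ge0$, $k\in\mathbb Z^d$; dyadic cubes $\lambda_{j,k}=\prod_{m=1}^d[k_m2^{-j},(k_m+1)2^{-j})$ of scale $j$; coefficients indexed by $(i,\lambda)$; $\Lambda_j$ = pairs $(i,\lambda)$ with $\lambda$ of scale $j$. $b^{s,q}_p$: sequences $(c^{(i)}_\lambda)$ with $\big(\big(\sum_{(i,\lambda)\in\Lambda_j}|c^{(i)}_\lambda2^{(s-d/p)j}|^p\big)^{1/p}\big)_{j\ge0}\in\ell^q$ (supremum if $p=\infty$), with the topology of the corresponding $\ell^q$ (quasi-)norm. Divergence exponent $\delta_{\mathcal C}(x)$: supremum of $\gamma$ such that there exist $C>0$ and $(i_n,j_n,k_n)$ with $j_n\to\infty$ and $|c^{(i_n)}_{j_n,k_n}\psi^{(i_n)}_{j_n,k_n}(x)|\ge C2^{\gamma j_n}$. Maximal divergence in a nonempty open $A$: (i) $\delta_{\mathcal C}(x)\in[-s,d/p-s]$ for all $x\in A$; (ii) $\delta_{\mathcal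 C}=-s$ a.e. on $A$; (iii) for every nonempty open $B\subset A$ and $\gamma\in[-s,d/p-s]$, $\dim_H\{x\in B:\delta_{\mathcal C}(x)=\gamma\}=d-sp-\gamma p$ (for $p=\infty$: $\delta_{\mathcal C}=-s$ on $A$). Dyadic covering property: there exist $C_0>0$ and finitely many triplets $(i_l,j_l,k_l)$ with $j_l\ge1$ such that every $x\in[0,1)^d$ has some $l$ with $|\psi^{(i_l)}(2^{j_l}x-k_l)|\ge C_0$. *)

(* Defs.v *)
From Stdlib Require Import Reals ZArith.
From Stdlib Require List.
From mathcomp Require Import all_boot.
Set Implicit Arguments.
Unset Strict Implicit.
Unset Printing Implicit Defensive.
Open Scope R_scope.

Definition Cpx := (R * R)%type.
Definition Cmod (z : Cpx) : R := sqrt (fst z * fst z + snd z * snd z).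
Definition Cmul (z w : Cpx) : Cpx :=
  (fst z * fst w - snd z * snd w, fst z * snd w + snd z * fst w).
Definition Csub (z w : Cpx) : Cpx := (fst z - fst w, snd z - snd w).

Definition Rd (d : nat) := 'I_d -> R.
Definition Zd (d : nat) := 'I_d -> Z.

Definition Rsum (d : nat) (f : 'I_d -> R) : R := \big[Rplus/0]_(m < d) f m.
Definition Rprod (d : nat) (f : 'I_d -> R) : R := \big[Rmult/1]_(m < d) f m.

Definition enorm (d : nat) (x : Rd d) : R := sqrt (Rsum (fun m => x m * x m)).
Definition edist (d : nat) (x y : Rd d) : R := enorm (fun m => x m - y m).

Definition openRd (d : nat) (B : Rd d -> Prop) : Prop :=
  forall x, B x -> exists r, 0 < r /\ forall y, edist x y < r -> B y.

(** Power with the convention 0^y = 0 (used only for y > 0). *)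
Definition rpow (x y : R) : R := if Rlt_dec 0 x then Rpower x y else 0.

Definition lebesgue_null (d : nat) (E : Rd d -> Prop) : Prop :=
  forall eps, 0 < eps ->
  exists lo hi : nat -> Rd d,
    (forall n m, lo n m < hi n m) /\
    (forall x, E x -> exists n, forall m, lo n m <= x m <= hi n m) /\
    (forall n, sum_f_R0 (fun k => Rprod (fun m => hi k m - lo k m)) n <= eps).

Definition hausdorff_null (d : nat) (t : R) (E : Rd d -> Prop) : Prop :=
  forall eps, 0 < eps ->
  exists (U : nat -> Rd d -> Prop) (r : nat -> R),
    (forall n, 0 < r n) /\
    (forall n x y, U n x -> U n y -> edist x y <= r n) /\
    (forall x, E x -> exists n, U n x) /\
    (forall n, sum_f_R0 (fun k => Rpower (r k) t) n <= eps).

(** dim_H E = a  (a >= 0), with the convention dim_H (empty) = -infinity,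
    so that dim_H E = a forces E to be nonempty. *)
Definition dimH_eq (d : nat) (E : Rd d -> Prop) (a : R) : Prop :=
  (exists x, E x) /\
  (forall t, a < t -> hausdorff_null t E) /\
  (forall t, 0 < t -> t < a -> ~ hausdorff_null t E).

Inductive expo := EFin of R | EInf.
Definition expo_pos (p : expo) : Prop :=
  match p with EFin r => 0 < r | EInf => True end.
Definition d_over (d : nat) (p : expo) : R :=
  match p with EFin r => INR d / r | EInf => 0 end.

Definition coefs (d N : nat) := 'I_N -> nat -> Zd d -> Cpx.

Definition coef_sub d N (c c' : coefs d N) : coefs d N :=
  fun i j k => Csub (c i j k) (c' i j k).

Definition nnsum (X : Type) (f : X -> R) (v : R) : Prop :=
  is_lub (fun u => exists l : list X, List.NoDup l /\
                    u = List.fold_right (fun x acc => f x + acc) 0 l) v.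

Definition level_val d N (s : R) (p : expo) (c : coefs d N) (j : nat) (a : R)
  : Prop :=
  match p with
  | EFin r =>
      exists S, nnsum (fun ik : 'I_N * Zd d =>
                   rpow (Cmod (c ik.1 j ik.2) * Rpower 2 ((s - INR d / r) * INR j)) r) S
              /\ a = rpow S (/ r)
  | EInf =>
      is_lub (fun u => exists i k, u = Cmod (c i j k) * Rpower 2 (s * INR j)) a
  end.

Definition bnorm d N (s : R) (p q : expo) (c : coefs d N) (v : R) : Prop :=
  exists A : nat -> R, (forall j, level_val s p c j (A j)) /\
  match q with
  | EFin r =>
      exists S, is_lub (fun u => exists n, u = sum_f_R0 (fun j => rpow (A j) r) n) S
             /\ v = rpow S (/ r)
  | EInf => is_lub (fun u => exists j, u = A j) v
  end.

Definition in_b d N s p q (c : coefs d N) : Prop := exists v, bnorm s p q c v.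

Definition bclose d N s p q (c c' : coefs d N) (eps : R) : Prop :=
  exists v, bnorm s p q (coef_sub c' c) v /\ v < eps.

Definition b_open d N s p q (U : coefs d N -> Prop) : Prop :=
  forall c, in_b s p q c -> U c ->
  exists eps, 0 < eps /\
    forall c', in_b s p q c' -> bclose s p q c c' eps -> U c'.

Definition b_dense d N s p q (U : coefs d N -> Prop) : Prop :=
  forall c, in_b s p q c -> forall eps, 0 < eps ->
  exists c', in_b s p q c' /\ U c' /\ bclose s p q c c' eps.

Definition b_residual d N s p q (P : coefs d N -> Prop) : Prop :=
  exists U : nat -> coefs d N -> Prop,
    (forall n, b_open s p q (U n) /\ b_dense s p q (U n)) /\
    (forall c, in_b s p q c -> (forall n, U n c) -> P c).

Definition wav d N (psi : 'I_N -> Rd d -> Cpx) (i : 'I_N) (j : nat) (k : Zd d)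
  (x : Rd d) : Cpx :=
  psi i (fun m => pow 2 j * x m - IZR (k m)).

Definition div_exp d N (psi : 'I_N -> Rd d -> Cpx) (c : coefs d N) (x : Rd d)
  (delta : R) : Prop :=
  is_lub (fun g => exists C, 0 < C /\
            exists (i : nat -> 'I_N) (j : nat -> nat) (k : nat -> Zd d),
              (forall M, exists n0, forall n, (n0 <= n)%nat -> (M <= j n)%nat) /\
              (forall n, Cmod (Cmul (c (i n) (j n) (k n)) (wav psi (i n) (j n) (k n) x))
                         >= C * Rpower 2 (g * INR (j n))))
    delta.

Definition max_div d N (psi : 'I_N -> Rd d -> Cpx) (s : R) (p : expo)
  (c : coefs d N) (A : Rd d -> Prop) : Prop :=
  match p with
  | EFin r =>
      (forall x, A x -> exists delta, div_exp psi c x delta /\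
                        - s <= delta <= INR d / r - s) /\
      lebesgue_null (fun x => A x /\ ~ div_exp psi c x (- s)) /\
      (forall B : Rd d -> Prop, openRd B -> (exists x, B x) ->
         (forall x, B x -> A x) ->
         forall g, - s <= g <= INR d / r - s ->
           dimH_eq (fun x => B x /\ div_exp psi c x g) (INR d - s * r - g * r))
  | EInf => forall x, A x -> div_exp psi c x (- s)
  end.

Definition bounded_fun d N (psi : 'I_N -> Rd d -> Cpx) : Prop :=
  exists M, forall i x, Cmod (psi i x) <= M.

Definition fast_decay d N (psi : 'I_N -> Rd d -> Cpx) : Prop :=
  forall n : nat, exists Cn, forall i x, Cmod (psi i x) <= Cn / pow (1 + enorm x) n.

Definition dyadic_covering d N (psi : 'I_N -> Rd d -> Cpx) : Prop :=
  exists C0, 0 < C0 /\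
  exists L : list ('I_N * nat * Zd d),
    (forall t, List.In t L -> (1 <= t.1.2)%nat) /\
    forall x : Rd d, (forall m, 0 <= x m < 1) ->
      exists t, List.In t L /\ Cmod (wav psi t.1.1 t.1.2 t.2 x) >= C0.

(* Main.v *)
Require Import Defs.
From Stdlib Require Import Reals ZArith.
From mathcomp Require Import all_boot zify.
From Stdlib Require Import Lra Lia ClassicalEpsilon FunctionalExtensionality.
From Stdlib Require List Cantor.
Open Scope R_scope.

(** Write [D = d/p].  For each [n] let [U_n] be the set of sequences for which, at some
    scale [J >= n], all coefficients of index [(i_l, j + j_l, 2^(j_l + j - J) K + k_l)] with
    [J <= j <= n J] and [|K| <= n 2^J] exceed [2^((D - s)(j + j_l) - D J - J/n)].  Only
    finitely many coefficients are involved, so [U_n] is open; there are about [2^(J d)]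
    of them per scale and [O(J)] scales, so imposing the lower bound costs a quasi-norm of
    order [J^(1/q) 2^(-J/n)], which tends to [0], and [U_n] is dense.

    Let [c] lie in all the [U_n].  The covering property turns these lower bounds into
    divergence with exponent [D - s - D theta] at every [x] which for infinitely many [J]
    lies in a cube [K 2^-J + [0, 2^-j)^d] with [J] about [theta j]; taking [theta = 1]
    gives the exponent [-s] everywhere.  Conversely the fast decay and the count of the
    large coefficients of scale [j] show that the points of exponent at least [g] form,
    for any [c] in the space, a null set for [H^t] as soon as [t > d - s p - g p].

    For the lower bound on dimensions, nested cubes of the above form, at very sparse
    scales, give a Cantor set whose natural parametrization by a cube of [R^d] has an
    inverse that is Hoelder of every exponent [tau < theta].  A countable family of sets
    null in dimensions [t_m < d theta] therefore cannot cover it: the preimages would be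
    null in dimension [d] and cover a cube.  With [d theta = d - s p - g p] this applies
    to the sets of exponent at least [g + 1/m] together with any [t]-null set. *)

Set Implicit Arguments.
Unset Strict Implicit.
Unset Printing Implicit Defensive.

(** * Real powers and finite sums *)


Lemma choice_fun (A B : Type) (P : A -> B -> Prop) :
  (forall a, exists b, P a b) -> exists f, forall a, P a (f a).
Proof.
move=> h; exists (fun a => proj1_sig (constructive_indefinite_description _ (h a))).
by move=> a; case: constructive_indefinite_description.
Qed.

Lemma Rpower_gt0 x y : 0 < Rpower x y.
Proof. exact: exp_pos. Qed.

Lemma Rpower2_nat n : Rpower 2 (INR n) = 2 ^ n.
Proof. by apply: Rpower_pow; lra. Qed.

Lemma Rpower2_le x y : x <= y -> Rpower 2 x <= Rpower 2 y.
Proof. by move=> h; apply: Rle_Rpower; lra. Qed.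

Lemma Rpower2_lt x y : x < y -> Rpower 2 x < Rpower 2 y.
Proof. by move=> h; apply: Rpower_lt; lra. Qed.

Lemma Rpower2_0 : Rpower 2 0 = 1.
Proof. by apply: Rpower_O; lra. Qed.

Lemma pow2_gt0 n : 0 < 2 ^ n.
Proof. by apply: pow_lt; lra. Qed.

Lemma pow2_ge1 n : 1 <= 2 ^ n.
Proof. by apply: pow_R1_Rle; lra. Qed.

Lemma INR_expn m n : INR (m ^ n)%N = INR m ^ n.
Proof.
elim: n => [|n ih] //=.
by rewrite expnS -ih -mult_INR.
Qed.

Lemma INR_leq m n : (m <= n)%N -> INR m <= INR n.
Proof. by move=> h; apply: le_INR; lia. Qed.

Lemma INR_ge0 n : 0 <= INR n.
Proof. exact: pos_INR. Qed.

Lemma nat_above x : exists n : nat, x <= INR n.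
Proof.
exists (Z.to_nat (up x)).
have [h1 _] := archimed x.
case: (Z_le_gt_dec 0 (up x)) => h.
  by rewrite INR_IZR_INZ Z2Nat.id //; lra.
have : IZR (up x) <= IZR 0 by apply: IZR_le; lia.
by have := INR_ge0 (Z.to_nat (up x)); lra.
Qed.

Lemma nat_ceil x : 0 <= x -> exists n : nat, x <= INR n <= x + 1.
Proof.
move=> h; exists (Z.to_nat (up x)); have [h1 h2] := archimed x.
have h0 : (0 <= up x)%Z by apply: le_IZR; lra.
by rewrite INR_IZR_INZ Z2Nat.id //; lra.
Qed.

Lemma Rpower2_ge_lin x : 0 <= x -> x / 2 <= Rpower 2 x.
Proof.
move=> h.
have h2 := ln_lt_2.
case: (Req_dec x 0) => [->|hx]; first by have := Rpower_gt0 2 0; lra.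
have h3 : 0 < x * ln 2 by apply: Rmult_lt_0_compat; lra.
have := exp_ineq1 (x * ln 2); rewrite /Rpower => h4.
have : 1 + x * ln 2 < exp (x * ln 2) by apply: h4; lra.
by nra.
Qed.

(** The exponential is the square of [2^(kappa J / 2)], which is at least [kappa J / 4], so it grows
    at least quadratically in [J]. *)
Lemma lin_exp_small kappa a b eps n0 :
  0 < kappa -> 0 <= a -> 0 <= b -> 0 < eps ->
  exists J : nat, (n0 <= J)%N /\
    (a * INR J + b) * Rpower 2 (- (kappa * INR J)) < eps.
Proof.
move=> hk ha hb he.
have [n hn] := nat_above (16 * (a + b + 1) / (kappa * kappa * eps)).
exists (n + n0 + 1)%N; split; first by lia.
set J := (n + n0 + 1)%N.
have hJ1 : 1 <= INR J by apply: (INR_leq (m := 1)); rewrite /J; lia.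
have hJ : 16 * (a + b + 1) / (kappa * kappa * eps) <= INR J.
  by apply: Rle_trans hn _; apply: INR_leq; rewrite /J; lia.
have hkk : 0 < kappa * kappa * eps by apply: Rmult_lt_0_compat => //; nra.
have hJ' : 16 * (a + b + 1) <= INR J * (kappa * kappa * eps).
  have := Rmult_le_compat_r _ _ _ (Rlt_le _ _ hkk) hJ.
  by rewrite /Rdiv Rmult_assoc Rinv_l; lra.
have hp : kappa * INR J / 4 <= Rpower 2 (kappa * INR J / 2).
  have -> : kappa * INR J / 4 = (kappa * INR J / 2) / 2 by field.
  by apply: Rpower2_ge_lin; nra.
have hsq : Rpower 2 (kappa * INR J) = Rpower 2 (kappa * INR J / 2) * Rpower 2 (kappa * INR J / 2).
  by rewrite -Rpower_plus; congr Rpower; field.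
rewrite Rpower_Ropp.
have hpos := Rpower_gt0 2 (kappa * INR J).
apply: (Rmult_lt_reg_r (Rpower 2 (kappa * INR J))) => //.
rewrite Rmult_assoc Rinv_l; last by lra.
rewrite hsq Rmult_1_r.
have hq : (kappa * INR J / 4) * (kappa * INR J / 4) <= Rpower 2 (kappa * INR J / 2) * Rpower 2 (kappa * INR J / 2).
  by apply: Rmult_le_compat => //; nra.
have hq' := Rmult_le_compat_l _ _ _ (Rlt_le _ _ he) hq.
apply: Rlt_le_trans hq'.
have -> : eps * (kappa * INR J / 4 * (kappa * INR J / 4)) = INR J * (INR J * (kappa * kappa * eps)) / 16 by field.
have : INR J * (16 * (a + b + 1)) <= INR J * (INR J * (kappa * kappa * eps)).
  by apply: Rmult_le_compat_l => //; lra.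
by nra.
Qed.

Lemma rpow_pos x y : 0 < x -> rpow x y = Rpower x y.
Proof. by rewrite /rpow; case: Rlt_dec. Qed.

Lemma rpow_npos x y : x <= 0 -> rpow x y = 0.
Proof. by rewrite /rpow; case: Rlt_dec => // *; lra. Qed.

Lemma rpow_ge0 x y : 0 <= rpow x y.
Proof.
rewrite /rpow; case: Rlt_dec => h; [exact: Rlt_le (Rpower_gt0 x y) | exact: Rle_refl].
Qed.

Lemma rpow_gt0 x y : 0 < x -> 0 < rpow x y.
Proof. by move=> h; rewrite rpow_pos //; exact: Rpower_gt0. Qed.

Lemma rpow_le x y r : 0 < r -> x <= y -> rpow x r <= rpow y r.
Proof.
move=> hr h; case: (Rlt_le_dec 0 x) => hx.
  by rewrite !rpow_pos; try lra; apply: Rle_Rpower_l; lra.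
by rewrite (rpow_npos _ hx); exact: rpow_ge0.
Qed.

Lemma rpow_lt x y r : 0 < r -> 0 < y -> x < y -> rpow x r < rpow y r.
Proof.
move=> hr hy h; case: (Rlt_le_dec 0 x) => hx.
  by rewrite !rpow_pos; try lra; apply: Rlt_Rpower_l; lra.
by rewrite (rpow_npos _ hx); exact: rpow_gt0.
Qed.

Lemma rpow_rpow x a b : a * b = 1 -> 0 <= x -> rpow (rpow x a) b = x.
Proof.
move=> hab hx; case: (Rlt_le_dec 0 x) => h.
  rewrite (rpow_pos _ h) rpow_pos; last exact: Rpower_gt0.
  by rewrite Rpower_mult hab Rpower_1.
by have -> : x = 0 by [lra]; rewrite (rpow_npos a) ?rpow_npos; lra.
Qed.

Lemma rpowK x r : 0 < r -> 0 <= x -> rpow (rpow x r) (/ r) = x.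
Proof. by move=> hr; apply: rpow_rpow; field; lra. Qed.

Lemma rpowVK x r : 0 < r -> 0 <= x -> rpow (rpow x (/ r)) r = x.
Proof. by move=> hr; apply: rpow_rpow; field; lra. Qed.

Lemma rpow_le_inv x y r : 0 < r -> rpow x r <= y -> x <= rpow y (/ r).
Proof.
move=> hr h; case: (Rlt_le_dec x 0) => hx; first by have := rpow_ge0 y (/ r); lra.
by rewrite -(rpowK hr hx); apply: rpow_le => //; exact: Rinv_0_lt_compat.
Qed.

Lemma Cmod_ge0 z : 0 <= Cmod z.
Proof. exact: sqrt_pos. Qed.

Lemma Cmod_sqr z : Cmod z * Cmod z = fst z * fst z + snd z * snd z.
Proof. by apply: sqrt_sqrt; nra. Qed.

Lemma Cmod_mul z w : Cmod (Cmul z w) = Cmod z * Cmod w.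
Proof.
rewrite /Cmod -sqrt_mult; try nra.
by congr sqrt; rewrite /Cmul /=; ring.
Qed.

Lemma Cmod_sub_ge z w : Cmod w - Cmod (Csub z w) <= Cmod z.
Proof.
have h1 := Cmod_sqr z; have h2 := Cmod_sqr w; have h3 := Cmod_sqr (Csub z w).
have p1 := Cmod_ge0 z; have p2 := Cmod_ge0 w; have p3 := Cmod_ge0 (Csub z w).
move: h1 h2 h3; rewrite /Csub /=.
set a := Cmod z in p1 *; set b := Cmod w in p2 *; set c := Cmod _ in p3 *.
move: (fst z) (snd z) (fst w) (snd w) => x y u v h1 h2 h3.
(* Cauchy-Schwarz for [z] and [z - w] by Lagrange's identity: the discarded term is the square of
   their determinant. *)
have h4 : (a * c) * (a * c) >= (x * (x - u) + y * (y - v)) * (x * (x - u) + y * (y - v)).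
  have -> : a * c * (a * c) = (a * a) * (c * c) by ring.
  rewrite h1 h3; have := Rle_0_sqr (x * (y - v) - y * (x - u)); rewrite /Rsqr; nra.
have h5 : a * c >= - (x * (x - u) + y * (y - v)).
  have := Rmult_le_pos _ _ p1 p3; nra.
have h6 : b * b <= (a + c) * (a + c) by nra.
nra.
Qed.

Lemma Cmod_sub_le z w : Cmod (Csub z w) <= Cmod z + Cmod w.
Proof.
have := Cmod_sub_ge (-fst w, -snd w) (Csub z w).
have -> : Csub (- fst w, - snd w) (Csub z w) = (- fst z, - snd z).
  by rewrite /Csub /=; congr pair; ring.
have e u : Cmod (- fst u, - snd u) = Cmod u by rewrite /Cmod /=; congr sqrt; ring.
by rewrite !e; lra.
Qed.

Lemma Cmod_real a : 0 <= a -> Cmod (a, 0) = a.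
Proof.
move=> h; rewrite /Cmod /=; have -> : a * a + 0 * 0 = a * a by ring.
exact: sqrt_square.
Qed.

Lemma Cmod_subxx z : Cmod (Csub z z) = 0.
Proof.
rewrite /Cmod /Csub /=; set a := (X in sqrt X).
by have -> : a = 0 by [rewrite /a; ring]; exact: sqrt_0.
Qed.

Lemma Rle_sum_f (f g : nat -> R) n :
  (forall k, (k <= n)%N -> f k <= g k) -> sum_f_R0 f n <= sum_f_R0 g n.
Proof. by move=> h; apply: sum_Rle => k hk; apply: h; lia. Qed.

Lemma sum_f_term (f : nat -> R) n k :
  (forall i, 0 <= f i) -> (k <= n)%N -> f k <= sum_f_R0 f n.
Proof.
move=> h; elim: n => [|n ih] hk /=.
  by have -> : k = 0%N by [lia]; lra.
case: (leqP k n) => hkn; first by have := ih hkn; have := h n.+1; lra.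
have -> : k = n.+1 by lia.
by have := cond_pos_sum f n h; lra.
Qed.

Lemma sum_f_le_support (f : nat -> R) b T n :
  (forall k, f k <= b) -> (forall k, (T < k)%N -> f k <= 0) -> 0 <= b ->
  sum_f_R0 f n <= INR T.+1 * b.
Proof.
move=> h1 h2 hb.
have hh : sum_f_R0 f n <= INR (minn n T).+1 * b.
  elim: n => [|n ih]; first by rewrite min0n /= ; have := h1 0%N; lra.
  change (sum_f_R0 f n.+1) with (sum_f_R0 f n + f n.+1).
  have [hT|hT] : (T < n.+1)%N \/ (n.+1 <= T)%N by lia.
    have -> : minn n.+1 T = minn n T by lia.
    by have := h2 _ hT; lra.
  have -> : minn n.+1 T = (minn n T).+1 by lia.
  by rewrite (S_INR (minn n T).+1); have := h1 n.+1; lra.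
apply: Rle_trans hh _; apply: Rmult_le_compat_r => //.
by apply: INR_leq; lia.
Qed.

Lemma geom_sum x n : x <> 1 -> sum_f_R0 (fun k => x ^ k) n = (1 - x ^ n.+1) / (1 - x).
Proof. exact: tech3. Qed.

(** * The quasi-norm of the sequence space *)


Definition lsum (X : Type) (f : X -> R) (l : list X) : R :=
  List.fold_right (fun x acc => f x + acc) 0 l.

Lemma lsum_ge0 (X : Type) (f : X -> R) l : (forall x, 0 <= f x) -> 0 <= lsum f l.
Proof. by move=> h; elim: l => [|x l ih] /=; [lra | have := h x; lra]. Qed.

Lemma lsum_ge_const (X : Type) (f : X -> R) l b :
  (forall x, List.In x l -> b <= f x) -> INR (size l) * b <= lsum f l.
Proof.
elim: l => [|x l ih] h; first by rewrite /=; lra.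
have h1 := h x (or_introl erefl).
have h2 : INR (size l) * b <= lsum f l by apply: ih => y hy; apply: h; right.
change (INR (size l).+1 * b <= f x + lsum f l).
by rewrite S_INR; lra.
Qed.

Lemma lsum_le_support (X : Type) (f g : X -> R) (b : R) (l0 l : list X) :
  0 <= b -> (forall x, f x <= g x + b) -> (forall x, ~ List.In x l0 -> f x <= g x) ->
  List.NoDup l -> lsum f l <= lsum g l + INR (size l0) * b.
Proof.
move=> hb h1 h2 hnd.
(* [m] keeps the elements of [l] that lie in [l0]; without duplicates, it is no longer than [l0],
   and only its elements pay the extra [b]. *)
suff [m [hm1 [hm2 hm3]]] : exists m, List.NoDup m /\ List.incl m l0 /\
    (forall x, List.In x m -> List.In x l) /\ lsum f l <= lsum g l + INR (size m) * b.
  have : INR (size m) <= INR (size l0).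
    by apply: le_INR; exact: List.NoDup_incl_length.
  by case: hm3 => _ hm3 hs; have := Rmult_le_compat_r _ _ _ hb hs; lra.
elim: hnd => [|x l' hx hnd [m [hm1 [hm2 [hm3 hm4]]]]].
  exists [::]; split; first exact: List.NoDup_nil.
  by split=> //; split=> //=; lra.
case: (excluded_middle_informative (List.In x l0)) => hin.
  exists (x :: m); split.
    by constructor=> // h; apply: hx; exact: hm3.
  split; first by move=> y /= [<-|hy] //; exact: hm2.
  split; first by move=> y /= [<-|hy]; [left|right; exact: hm3].
  change (f x + lsum f l' <= g x + lsum g l' + INR (size m).+1 * b).
  by rewrite S_INR; have := h1 x; lra.
exists m; split=> //; split=> //; split; first by move=> y hy; right; exact: hm3.
by rewrite /=; have := h2 x hin; lra.
Qed.

Lemma nnsum_exists (X : Type) (f : X -> R) b :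
  (forall l, List.NoDup l -> lsum f l <= b) ->
  exists v, nnsum f v /\ 0 <= v <= b.
Proof.
move=> h.
have [||v hv] := completeness (fun u => exists l, List.NoDup l /\ u = lsum f l).
- by exists b => u [l [hl ->]]; exact: h.
- by exists 0, [::]; split=> //; exact: List.NoDup_nil.
exists v; split=> //; case: hv => hv1 hv2; split.
  by apply: hv1; exists [::]; split=> //; exact: List.NoDup_nil.
by apply: hv2 => u [l [hl ->]]; exact: h.
Qed.

Lemma nnsum_le (X : Type) (f : X -> R) v l : nnsum f v -> List.NoDup l -> lsum f l <= v.
Proof. by move=> [h _] hl; apply: h; exists l. Qed.

Lemma nnsum_ge0 (X : Type) (f : X -> R) v : nnsum f v -> 0 <= v.
Proof. by move=> h; have := nnsum_le h (List.NoDup_nil _). Qed.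

Lemma d_over_ge0 d p : expo_pos p -> 0 <= d_over d p.
Proof.
case: p => [r|] /= h; last lra.
by apply: Rmult_le_pos; [exact: INR_ge0 | apply: Rlt_le; exact: Rinv_0_lt_compat].
Qed.

Section Levels.
Variables (d N : nat).
Implicit Types (c : coefs d N) (s : R) (p q : expo).

Definition wsum s r c j (ik : 'I_N * Zd d) : R :=
  rpow (Cmod (c ik.1 j ik.2) * Rpower 2 ((s - INR d / r) * INR j)) r.

Lemma level_val_ext s p c c' j a :
  (forall i k, c i j k = c' i j k) -> level_val s p c j a -> level_val s p c' j a.
Proof.
move=> h; case: p => [r|] /=.
  suff -> : (fun ik : 'I_N * Zd d => rpow (Cmod (c ik.1 j ik.2) * Rpower 2 ((s - INR d / r) * INR j)) r)
         = (fun ik : 'I_N * Zd d => rpow (Cmod (c' ik.1 j ik.2) * Rpower 2 ((s - INR d / r) * INR j)) r) by [].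
  by apply: functional_extensionality => ik; rewrite h.
suff -> : (fun u => exists (i : 'I_N) (k : Zd d), u = Cmod (c i j k) * Rpower 2 (s * INR j))
       = (fun u => exists (i : 'I_N) (k : Zd d), u = Cmod (c' i j k) * Rpower 2 (s * INR j)) by [].
apply: functional_extensionality => u; congr ex; apply: functional_extensionality => i.
by congr ex; apply: functional_extensionality => k; rewrite h.
Qed.

Lemma level_val_coef s p c j a i k : expo_pos p -> level_val s p c j a ->
  Cmod (c i j k) * Rpower 2 ((s - d_over d p) * INR j) <= a.
Proof.
case: p => [r|] /= hp.
  move=> [S [hS ->]]; apply: rpow_le_inv => //.
  have := nnsum_le (l := [:: (i, k)]) hS.
  rewrite /= Rplus_0_r; apply.
  by constructor=> //; exact: List.NoDup_nil.
by rewrite Rminus_0_r => -[h _]; apply: h; exists i, k.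
Qed.

Lemma bnorm_levels s p q c v : expo_pos q -> bnorm s p q c v ->
  exists A, (forall j, level_val s p c j (A j)) /\ forall j, A j <= v.
Proof.
move=> hq [A [hA h]]; exists A; split=> // j.
move: hq h; case: q => [r|] /= hr.
  move=> [S [[hS _] ->]]; apply: rpow_le_inv => //.
  apply: Rle_trans (hS _ (ex_intro _ j erefl)).
  by apply: (sum_f_term (f := fun j => rpow (A j) r)) => // i; exact: rpow_ge0.
by move=> [h _]; apply: h; exists j.
Qed.

Lemma bnorm_coef s p q c v i j k : expo_pos p -> expo_pos q -> bnorm s p q c v ->
  Cmod (c i j k) <= v * Rpower 2 ((d_over d p - s) * INR j).
Proof.
move=> hp hq /(bnorm_levels hq) [A [hA hv]].
have := level_val_coef i k hp (hA j) => h.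
have e : Rpower 2 ((s - d_over d p) * INR j) * Rpower 2 ((d_over d p - s) * INR j) = 1.
  by rewrite -Rpower_plus -Rpower2_0; congr Rpower; ring.
have h3 := Rpower_gt0 2 ((d_over d p - s) * INR j).
have h4 := Rle_trans _ _ _ h (hv j).
have := Rmult_le_compat_r _ _ _ (Rlt_le _ _ h3) h4.
by rewrite Rmult_assoc e Rmult_1_r.
Qed.

Lemma in_b_coef s p q c : expo_pos p -> expo_pos q -> in_b s p q c ->
  exists V, 0 < V /\ forall i j k, Cmod (c i j k) <= V * Rpower 2 ((d_over d p - s) * INR j).
Proof.
move=> hp hq [v hv]; exists (Rabs v + 1); split; first by have := Rabs_pos v; lra.
move=> i j k; apply: Rle_trans (bnorm_coef i j k hp hq hv) _.
apply: Rmult_le_compat_r; first exact: Rlt_le (Rpower_gt0 _ _).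
by have := Rle_abs v; lra.
Qed.

Lemma in_b_sum s r q c : 0 < r -> expo_pos q -> in_b s (EFin r) q c ->
  exists W, 0 < W /\ forall j l, List.NoDup l -> lsum (wsum s r c j) l <= W.
Proof.
move=> hr hq [v /(bnorm_levels hq) [A [hA hv]]].
exists (rpow v r + 1); split; first by have := rpow_ge0 v r; lra.
move=> j l hl; have [S [hS hSA]] := hA j.
have h1 := nnsum_le hS hl.
have h2 : S <= rpow v r.
  rewrite -(rpowVK hr (nnsum_ge0 hS)) -hSA; exact: rpow_le.
by rewrite /wsum; lra.
Qed.

(** For a finite exponent [r], [B] bounds sums of [r]-th powers, so the resulting bound on the
    quasi-norm is [B^(1/r)] and not [B]. *)
Definition ellq_bd q (A : nat -> R) B :=
  match q with
  | EFin r => forall n, sum_f_R0 (fun j => rpow (A j) r) n <= B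
  | EInf => forall j, A j <= B
  end.

Lemma bnorm_exists s p q c A B :
  expo_pos q -> (forall j, level_val s p c j (A j)) -> ellq_bd q A B ->
  exists v, bnorm s p q c v /\
    v <= match q with EFin r => rpow B (/ r) | EInf => B end.
Proof.
move=> hq hA; move: hq; case: q => [r|] /= hr hB.
  have [||S hS] := completeness (fun u => exists n, u = sum_f_R0 (fun j => rpow (A j) r) n).
  - by exists B => u [n ->].
  - by eexists; exists 0%N; reflexivity.
  exists (rpow S (/ r)); split; first by exists A; split=> //; exists S.
  apply: rpow_le; first exact: Rinv_0_lt_compat.
  by case: hS => _; apply => u [n ->].
have [||S hS] := completeness (fun u => exists j, u = A j).
- by exists B => u [n ->].
- by exists (A 0%N), 0%N.
exists S; split; first by exists A.
by case: hS => _; apply => u [n ->].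
Qed.

Lemma ellq_bd_eventually q A A' T B :
  (forall j, (T < j)%N -> A' j = A j) -> ellq_bd q A B ->
  exists B', ellq_bd q A' B'.
Proof.
move=> h; case: q => [r|] /= hB.
  exists (B + sum_f_R0 (fun j => rpow (A' j) r) T) => n.
  suff : sum_f_R0 (fun j => rpow (A' j) r) n <=
         sum_f_R0 (fun j => rpow (A j) r) n + sum_f_R0 (fun j => rpow (A' j) r) T.
    by have := hB n; lra.
  elim: n => [|n ih].
    have := sum_f_term (f := fun j => rpow (A' j) r) (n := T) (k := 0%N) (fun j => rpow_ge0 _ _) (leq0n T).
    by rewrite /=; have := rpow_ge0 (A 0%N) r; lra.
  have [hn|hn] : (T < n.+1)%N \/ (n.+1 <= T)%N by lia.
    by rewrite /= h //; lra.
  have : sum_f_R0 (fun j => rpow (A' j) r) n.+1 <= sum_f_R0 (fun j => rpow (A' j) r) T.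
    elim: T {h ih} hn => [|T ihT] hn; first by lia.
    have [e|hn'] : n.+1 = T.+1 \/ (n.+1 <= T)%N by lia.
      by rewrite e; exact: Rle_refl.
    by apply: Rle_trans (ihT hn') _; rewrite /=; have := rpow_ge0 (A' T.+1) r; lra.
  have := cond_pos_sum (fun j => rpow (A j) r) n.+1 (fun j => rpow_ge0 _ _).
  by lra.
exists (B + sum_f_R0 (fun j => Rabs (A' j)) T + Rabs B) => j.
have h0 := cond_pos_sum (fun j => Rabs (A' j)) T (fun j => Rabs_pos _).
have hb := Rle_abs (- B); rewrite Rabs_Ropp in hb.
have hb' := Rabs_pos B.
have [hj|hj] : (T < j)%N \/ (j <= T)%N by lia.
  by rewrite h //; have := hB j; lra.
have := sum_f_term (f := fun j => Rabs (A' j)) (fun j => Rabs_pos _) hj.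
by have := Rle_abs (A' j); lra.
Qed.

(* Replacing finitely many coefficients keeps a sequence in [b^{s,q}_p]; since
   each new term is at most the old one plus a bound, the quasi-triangle
   inequality is not needed. *)
Lemma level_val_perturb s p c c' j a b (l0 : list ('I_N * Zd d)) :
  expo_pos p -> 0 <= b ->
  (forall i k, Cmod (c' i j k) <= b \/ c' i j k = c i j k) ->
  (forall i k, ~ List.In (i, k) l0 -> c' i j k = c i j k) ->
  level_val s p c j a -> (0 < N)%N ->
  exists a', level_val s p c' j a'.
Proof.
move=> hp hb h1 h2 hc hN.
move: hp hc; case: p => [r|] /= hr.
  move=> [S [hS _]].
  set w := Rpower 2 ((s - INR d / r) * INR j).
  have hw : 0 < w by exact: Rpower_gt0.
  have hf x : rpow (Cmod (c' x.1 j x.2) * w) r <= rpow (Cmod (c x.1 j x.2) * w) r + rpow (b * w) r.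
    have p1 := rpow_ge0 (b * w) r; have p2 := rpow_ge0 (Cmod (c x.1 j x.2) * w) r.
    case: (h1 x.1 x.2) => [h|->]; last by lra.
    have : rpow (Cmod (c' x.1 j x.2) * w) r <= rpow (b * w) r.
      by apply: rpow_le => //; apply: Rmult_le_compat_r => //; lra.
    by lra.
  have [l hl|v [hv _]] := nnsum_exists (X := ('I_N * Zd d)%type)
     (f := fun x => rpow (Cmod (c' x.1 j x.2) * w) r)
     (b := S + INR (size l0) * rpow (b * w) r).
    apply: Rle_trans (lsum_le_support (rpow_ge0 _ _) hf (l0 := l0) _ hl) _.
      by case=> i k hx /=; rewrite h2 //; exact: Rle_refl.
    by have := nnsum_le hS hl; rewrite -/w; lra.
  by exists (rpow v (/ r)), v.
move=> hc.
set w := Rpower 2 (s * INR j).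
have hw : 0 < w by exact: Rpower_gt0.
have [||v hv] := completeness (fun u => exists (i : 'I_N) (k : Zd d), u = Cmod (c' i j k) * w).
- exists (Rabs a + b * w) => u [i [k ->]].
  have pb : 0 <= b * w by apply: Rmult_le_pos => //; lra.
  case: (h1 i k) => [h|->].
    by have := Rabs_pos a; have := Rmult_le_compat_r _ _ _ (Rlt_le _ _ hw) h; lra.
  have : Cmod (c i j k) * w <= a by case: hc => hc _; apply: hc; exists i, k.
  by have := Rle_abs a; lra.
- by eexists; exists (Ordinal hN), (fun=> 0%Z); reflexivity.
by exists v.
Qed.

Lemma level_val_small s p c j b (l0 : list ('I_N * Zd d)) :
  expo_pos p -> 0 <= b ->
  (forall i k, Cmod (c i j k) * Rpower 2 ((s - d_over d p) * INR j) <= b) ->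
  (forall i k, ~ List.In (i, k) l0 -> Cmod (c i j k) = 0) -> (0 < N)%N ->
  exists a, level_val s p c j a /\
    a <= match p with EFin r => rpow (INR (size l0) * rpow b r) (/ r) | EInf => b end.
Proof.
move=> hp hb h1 h2 hN.
move: hp h1; case: p => [r|] /= hr h1.
  set w := Rpower 2 ((s - INR d / r) * INR j).
  have hw : 0 < w by exact: Rpower_gt0.
  have [l hl|v [hv hvb]] := nnsum_exists (X := ('I_N * Zd d)%type)
     (f := fun x => rpow (Cmod (c x.1 j x.2) * w) r)
     (b := INR (size l0) * rpow b r).
    have := lsum_le_support (f := fun x => rpow (Cmod (c x.1 j x.2) * w) r) (g := fun x => 0)
      (l0 := l0) (l := l) (rpow_ge0 b r).
    have -> : lsum (fun=> 0) l = 0 by elim: (l) => //= x l' ->; ring.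
    move=> hs; apply: Rle_trans (hs _ _ hl) _; last by rewrite Rplus_0_l; exact: Rle_refl.
      by move=> x; rewrite Rplus_0_l; apply: rpow_le => //; exact: h1.
    by case=> i k hx /=; rewrite h2 // Rmult_0_l rpow_npos; lra.
  exists (rpow v (/ r)); split; first by exists v.
  by apply: rpow_le; [exact: Rinv_0_lt_compat | lra].
have [||v hv] := completeness (fun u => exists (i : 'I_N) (k : Zd d), u = Cmod (c i j k) * Rpower 2 (s * INR j)).
- by exists b => u [i [k ->]]; have := h1 i k; rewrite Rminus_0_r.
- by eexists; exists (Ordinal hN), (fun=> 0%Z); reflexivity.
exists v; split=> //; case: hv => _; apply => u [i [k ->]].
by have := h1 i k; rewrite Rminus_0_r.
Qed.

End Levels.

(** * Saturated sequences *)


Lemma In_mem (T : eqType) (x : T) (l : seq T) : x \in l -> List.In x l.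
Proof.
elim: l => //= y l ih; rewrite inE => /orP [/eqP ->|h]; first by left.
by right; exact: ih.
Qed.

Lemma box_list d (B : nat) : exists l : list (Zd d),
  size l = ((2 * B + 1) ^ d)%N /\
  forall K : Zd d, (forall m, Rabs (IZR (K m)) <= INR B) -> List.In K l.
Proof.
pose F (f : {ffun 'I_d -> 'I_((2 * B).+1)}) : Zd d := fun m => (Z.of_nat (f m) - Z.of_nat B)%Z.
exists (List.map F (enum {ffun 'I_d -> 'I_((2 * B).+1)})); split.
  transitivity (size (enum {ffun 'I_d -> 'I_((2 * B).+1)})); first exact: List.length_map.
  by rewrite -cardE card_ffun !card_ord addn1.
move=> K hK.
have hb m : (- Z.of_nat B <= K m <= Z.of_nat B)%Z.
  have := hK m; rewrite INR_IZR_INZ -abs_IZR => /le_IZR; lia.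
apply/List.in_map_iff; exists [ffun m => inord (Z.to_nat (K m + Z.of_nat B))].
split; last by apply: In_mem; rewrite mem_enum.
apply: functional_extensionality => m; rewrite /F ffunE inordK; first by have := hb m; lia.
by have := hb m; lia.
Qed.

Section Generic.
Variables (d N : nat).
Implicit Types (c : coefs d N) (s : R) (p q : expo) (L : list ('I_N * nat * Zd d)).

(* The wavelet indices obtained from the covering triplets [L] by rescaling to
   the cubes of scale [j0] whose corner is one of the points [K 2^-J]. *)
Definition hit L (n J : nat) (i : 'I_N) (j : nat) (k : Zd d) : Prop :=
  exists t j0 (K : Zd d), List.In t L /\ (J <= j0)%N /\ (j0 <= n * J)%N /\
    (forall m, Rabs (IZR (K m)) <= INR n * 2 ^ J) /\
    i = t.1.1 /\ j = (j0 + t.1.2)%N /\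
    k = fun m => (2 ^ Z.of_nat (t.1.2 + (j0 - J)) * K m + t.2 m)%Z.

(** With the weight [2^((s - d/p) j)] of level [j] this becomes [2^(-(d/p) J - J/n)], the same for
    all [j]: about [2^(d J)] such entries have an [l^p] size of order [2^(-J/n)]. *)
Definition thr s p (n J j : nat) : R :=
  Rpower 2 ((d_over d p - s) * INR j - d_over d p * INR J - INR J / INR n).

(** The margin [eta] is common to all the indices of [hit], so that a small perturbation of the
    sequence preserves the condition. *)
Definition saturated s p L (n : nat) c : Prop :=
  exists (J : nat) (eta : R), (n <= J)%N /\ 0 < eta /\
    forall i j k, hit L n J i j k -> thr s p n J j + eta <= Cmod (c i j k).

Lemma max_scale L : exists T : nat, forall t, List.In t L -> (t.1.2 <= T)%N.
Proof.
elim: L => [|t L [T hT]]; first by exists 0%N.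
exists (maxn t.1.2 T) => u [<-|/hT]; lia.
Qed.

Lemma hit_scale L T n J i j k : (forall t, List.In t L -> (t.1.2 <= T)%N) ->
  hit L n J i j k -> (j <= n * J + T)%N.
Proof. by move=> h [t [j0 [K [ht [h1 [h2 [_ [_ [-> _]]]]]]]]]; have := h _ ht; lia. Qed.

(** For a given [j] the triplet determines [j0 = j - t.1.2], so a triplet of [L] and a corner [K] in
    a box parametrize the indices. *)
Lemma hit_list L n J j : exists l : list ('I_N * Zd d),
  size l = (size L * (2 * (n * 2 ^ J) + 1) ^ d)%N /\
  forall i k, hit L n J i j k -> List.In (i, k) l.
Proof.
have [lK [hs hK]] := box_list d (n * 2 ^ J)%N.
pose F (tK : ('I_N * nat * Zd d) * Zd d) : 'I_N * Zd d :=
  (tK.1.1.1, fun m => (2 ^ Z.of_nat (tK.1.1.2 + (j - tK.1.1.2 - J)) * tK.2 m + tK.1.2 m)%Z).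
exists (List.map F (List.list_prod L lK)); split.
  transitivity (size (List.list_prod L lK)); first exact: List.length_map.
  rewrite -hs; exact: List.length_prod.
move=> i k [t [j0 [K [ht [h1 [h2 [hKb [-> [hj ->]]]]]]]]].
apply/List.in_map_iff; exists (t, K); split.
  by rewrite /F /=; have -> : (j - t.1.2 - J)%N = (j0 - J)%N by lia.
apply/List.in_prod => //; apply: hK => m; have := hKb m.
by rewrite mult_INR INR_expn.
Qed.

Lemma Rpower2_abs_le x (j T : nat) : (j <= T)%N -> Rpower 2 (x * INR j) <= Rpower 2 (Rabs x * INR T).
Proof.
move=> h; apply: Rpower2_le.
have h1 := INR_leq h; have h2 := INR_ge0 j; have h3 := Rabs_pos x; have h4 := Rle_abs x.
by nra.
Qed.

Lemma saturated_open s p q L n : expo_pos p -> expo_pos q ->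
  b_open s p q (saturated s p L n).
Proof.
move=> hp hq c hc [J [eta [hJ [he h]]]].
have [T hT] := max_scale L.
set Q := Rpower 2 (Rabs (d_over d p - s) * INR (n * J + T)).
have hQ : 0 < Q by exact: Rpower_gt0.
(* [Q] dominates the factor of [bnorm_coef] up to scale [n J + T], so a quasi-norm below this value
   bounds every coefficient concerned by [eta / 2]. *)
exists (eta / (2 * Q)); split; first by apply: Rdiv_lt_0_compat; lra.
move=> c' hc' [v [hv hve]]; exists J, (eta / 2); split=> //; split; first by lra.
move=> i j k hh; have h1 := h _ _ _ hh.
have h2 := bnorm_coef i j k hp hq hv.
have h3 := Cmod_sub_ge (c' i j k) (c i j k).
have hj := hit_scale hT hh.
have h4 := Rpower2_abs_le (d_over d p - s) hj; rewrite -/Q in h4.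
have h5 := Rpower_gt0 2 ((d_over d p - s) * INR j).
have h6 : Cmod (coef_sub c' c i j k) <= eta / 2.
  apply: Rle_trans h2 _.
  apply: (Rle_trans _ (eta / (2 * Q) * Rpower 2 ((d_over d p - s) * INR j))).
    by apply: Rmult_le_compat_r; lra.
  have -> : eta / 2 = eta / (2 * Q) * Q by field; lra.
  by apply: Rmult_le_compat_l => //; apply: Rlt_le; apply: Rdiv_lt_0_compat; lra.
have h7 : Cmod (Csub (c' i j k) (c i j k)) <= eta / 2 by exact: h6.
have h8 : Cmod (Csub (c' i j k) (c i j k)) = Cmod (Csub (c i j k) (c' i j k)).
  by rewrite /Cmod /Csub /=; congr sqrt; ring.
have h9 := Cmod_sub_ge (c i j k) (Csub (c i j k) (c' i j k)).
by lra.
Qed.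

(** The cost of modifying one level. The count is at most a constant times [2^(d J)], which cancels
    the factor [2^(-d J)] in [b^r]; what is left is [2^(-J/n)], with [C] independent of [J]. The [4]
    is the one that arises in [saturated_dense]. *)
Lemma level_size s p (M n : nat) : expo_pos p -> (0 < n)%N -> exists C, 0 < C /\ forall J : nat,
  let b := 4 * Rpower 2 (- (d_over d p * INR J) - INR J / INR n) in
  match p with
  | EFin r => rpow (INR (M * (2 * (n * 2 ^ J) + 1) ^ d)%N * rpow b r) (/ r)
  | EInf => b
  end <= C * Rpower 2 (- (INR J / INR n)).
Proof.
move=> hp hn; move: hp; case: p => [r|] /= hr; last first.
  exists 4; split; first lra.
  move=> J; rewrite Rmult_0_l; apply: Req_le; congr (_ * Rpower _ _); ring.
have hn1 : 1 <= INR n by apply: (INR_leq (m := 1)).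
set Z0 := (INR M + 1) * (3 * INR n) ^ d * Rpower 4 r.
have hZ : 0 < Z0.
  apply: Rmult_lt_0_compat; last exact: Rpower_gt0.
  apply: Rmult_lt_0_compat; first by have := INR_ge0 M; lra.
  by apply: pow_lt; lra.
exists (rpow Z0 (/ r)); split; first exact: rpow_gt0.
move=> J.
set b := 4 * _.
have hb : 0 < b by apply: Rmult_lt_0_compat; [lra | exact: Rpower_gt0].
have e : rpow b r = Rpower 4 r * Rpower 2 (- (INR d * INR J)) * Rpower 2 (- (INR J / INR n) * r).
  rewrite rpow_pos // /b -Rpower_mult_distr; [|lra|exact: Rpower_gt0].
  rewrite Rpower_mult Rmult_assoc -Rpower_plus; congr (_ * Rpower _ _).
  by field; split; lra.
have h1 : INR (M * (2 * (n * 2 ^ J) + 1) ^ d)%N <= (INR M + 1) * (3 * INR n) ^ d * Rpower 2 (INR d * INR J).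
  rewrite mult_INR INR_expn plus_INR !mult_INR INR_expn.
  have -> : INR 2 = 2 by rewrite /=; ring.
  have -> : INR 1 = 1 by [].
  have -> : Rpower 2 (INR d * INR J) = (2 ^ J) ^ d.
    by rewrite -pow_mult -Rpower2_nat mult_INR Rmult_comm.
  rewrite Rmult_assoc -Rpow_mult_distr.
  have h2 := pow2_ge1 J.
  have hM := INR_ge0 M.
  have hn2 : 1 <= INR n * 2 ^ J by nra.
  apply: Rmult_le_compat; [lra | by apply: pow_le; lra | lra |].
  by apply: pow_incr; lra.
have h2 : INR (M * (2 * (n * 2 ^ J) + 1) ^ d)%N * rpow b r <= Z0 * Rpower 2 (- (INR J / INR n) * r).
  rewrite e /Z0.
  set u := Rpower 2 (- (INR J / INR n) * r).
  have e2 : Rpower 2 (INR d * INR J) * Rpower 2 (- (INR d * INR J)) = 1.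
    by rewrite -Rpower_plus -Rpower2_0; congr Rpower; ring.
  have hu : 0 < Rpower 4 r * Rpower 2 (- (INR d * INR J)) * u.
    by apply: Rmult_lt_0_compat; [apply: Rmult_lt_0_compat|]; exact: Rpower_gt0.
  have := Rmult_le_compat_r _ _ _ (Rlt_le _ _ hu) h1.
  move=> h3; apply: Rle_trans h3 _; apply: Req_le.
  transitivity ((INR M + 1) * (3 * INR n) ^ d * Rpower 4 r * u * (Rpower 2 (INR d * INR J) * Rpower 2 (- (INR d * INR J)))).
    by ring.
  by rewrite e2; ring.
apply: Rle_trans (rpow_le (Rinv_0_lt_compat _ hr) h2) _.
rewrite !rpow_pos //; last by apply: Rmult_lt_0_compat => //; exact: Rpower_gt0.
rewrite -Rpower_mult_distr //; last exact: Rpower_gt0.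
rewrite (Rpower_mult 2); apply: Req_le; congr (_ * Rpower _ _); field; split; lra.
Qed.

(** At most [n J + T + 1] levels contribute, so for a finite exponent [r] the sum of [r]-th powers
    is of order [J 2^(-r J/n)]. The scale [J] is fixed before the level values [A] are known. *)
Lemma ellq_small q C (n T : nat) n0 eps : expo_pos q -> (0 < n)%N -> 0 < C -> 0 < eps ->
  exists J : nat, (n0 <= J)%N /\ forall A : nat -> R,
    (forall j, A j <= C * Rpower 2 (- (INR J / INR n))) ->
    (forall j, (n * J + T < j)%N -> A j <= 0) ->
    exists B, ellq_bd q A B /\
      match q with EFin r => rpow B (/ r) | EInf => B end < eps.
Proof.
move=> hq hn hC he.
have hn1 : 1 <= INR n by apply: (INR_leq (m := 1)).
move: hq; case: q => [r|] /= hr; last first.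
  have [|||J [hJ h]] := @lin_exp_small (/ INR n) 0 C eps n0 _ _ _ he; try lra.
    by apply: Rinv_0_lt_compat; lra.
  exists J; split=> // A hA _; exists (C * Rpower 2 (- (INR J / INR n))); split=> //.
  move: h; rewrite Rmult_0_l Rplus_0_l /Rdiv.
  by rewrite (Rmult_comm (INR J)).
have hCr : 0 < rpow C r by exact: rpow_gt0.
have her : 0 < rpow eps r by exact: rpow_gt0.
have [|||J [hJ h]] := @lin_exp_small (r / INR n) (INR n * rpow C r) (INR (T.+1) * rpow C r) (rpow eps r) n0 _ _ _ her.
- by apply: Rdiv_lt_0_compat; lra.
- by apply: Rmult_le_pos; lra.
- by apply: Rmult_le_pos; [exact: INR_ge0 | lra].
exists J; split=> // A hA1 hA2.
set th := C * Rpower 2 (- (INR J / INR n)).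
have hth : 0 < th by apply: Rmult_lt_0_compat => //; exact: Rpower_gt0.
exists (INR (n * J + T).+1 * rpow th r); split.
  move=> k; apply: sum_f_le_support; last exact: rpow_ge0.
    by move=> j; apply: rpow_le => //; exact: hA1.
  by move=> j hj; rewrite rpow_npos; [lra | exact: hA2].
rewrite -[X in _ < X](rpowK hr (Rlt_le _ _ he)).
apply: rpow_lt => //; first exact: Rinv_0_lt_compat.
have e : rpow th r = rpow C r * Rpower 2 (- (r / INR n * INR J)).
  rewrite !rpow_pos // /th -Rpower_mult_distr //; last exact: Rpower_gt0.
  by rewrite Rpower_mult; congr (_ * Rpower _ _); field; lra.
rewrite e S_INR plus_INR mult_INR.
by move: h; rewrite S_INR; lra.
Qed.

(** Each hit coefficient below twice its threshold is replaced by that value, and the others are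
    kept. Whatever the sequence, the change is then at most four thresholds, and [level_size] and
    [ellq_small] make its quasi-norm small. *)
Lemma saturated_dense s p q L n : expo_pos p -> expo_pos q -> (0 < N)%N -> (0 < n)%N ->
  b_dense s p q (saturated s p L n).
Proof.
move=> hp hq hN hn c hc eps he.
have [T hT] := max_scale L.
have [C [hC hsize]] := level_size s (size L) hp hn.
have [J [hJ hsmall]] := ellq_small T n hq hn hC he.
pose th j := thr s p n J j.
have hth j : 0 < th j by exact: Rpower_gt0.
pose P i j k := hit L n J i j k /\ Cmod (c i j k) < 2 * th j.
pose c' : coefs d N := fun i j k =>
  if excluded_middle_informative (P i j k) then (2 * th j, 0) else c i j k.
have c'P i j k : (P i j k /\ c' i j k = (2 * th j, 0)) \/ (~ P i j k /\ c' i j k = c i j k).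
  by rewrite /c'; case: excluded_middle_informative => h; [left|right].
have c'_nhit i j k : ~ hit L n J i j k -> c' i j k = c i j k.
  by move=> h; case: (c'P i j k) => [[[]]|[]].
have c'_far i j k : (n * J + T < j)%N -> c' i j k = c i j k.
  by move=> h; apply: c'_nhit => /(hit_scale hT); lia.
have c'_le i j k : Cmod (c' i j k) <= 2 * th j \/ c' i j k = c i j k.
  case: (c'P i j k) => [[_ ->]|[_ ->]]; last by right.
  by left; rewrite Cmod_real; have := hth j; lra.
have diff_le i j k : Cmod (coef_sub c' c i j k) <= 4 * th j.
  rewrite /coef_sub; case: (c'P i j k) => [[[_ hlt] ->]|[_ ->]].
    apply: Rle_trans (Cmod_sub_le _ _) _.
    by rewrite Cmod_real; have := hth j; lra.
  by rewrite Cmod_subxx; have := hth j; lra.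
have diff0 i j k : c' i j k = c i j k -> Cmod (coef_sub c' c i j k) = 0.
  by rewrite /coef_sub => ->; exact: Cmod_subxx.
exists c'; split; [|split].
- case: hc => v [A [hA hv]].
  have [A' hA'] : exists A' : nat -> R, forall j, level_val s p c' j (A' j) /\ ((n * J + T < j)%N -> A' j = A j).
    apply: (choice_fun (P := fun j a => level_val s p c' j a /\ ((n * J + T < j)%N -> a = A j))) => j.
    case: (ltnP (n * J + T) j) => hj.
      by exists (A j); split=> //; apply: level_val_ext (hA j) => i k; rewrite c'_far.
    have [l [_ hl]] := hit_list L n J j.
    have [||a' ha'] := level_val_perturb (l0 := l) hp _ (fun i k => c'_le i j k) _ (hA j) hN.
    - by have := hth j; lra.
    - by move=> i k hin; apply: c'_nhit => /hl.
    by exists a'; split.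
  have [B hB] : exists B, ellq_bd q A B.
    move: hv; case: (q) => [r|] /= .
      by move=> [S [hS _]]; exists S => m; case: hS => hS _; apply: hS; exists m.
    by move=> hS; exists v => m; case: hS => hS _; apply: hS; exists m.
  have [B' hB'] := ellq_bd_eventually (fun j => proj2 (hA' j)) hB.
  have [v' [hv' _]] := bnorm_exists hq (fun j => proj1 (hA' j)) hB'.
  by exists v'.
- set T' := (n * J + T)%N.
  (* [y] is below all thresholds of scales up to [T'], so a modulus of at least [2 th j] exceeds
     [th j] by at least the margin [y]. *)
  pose y := Rpower 2 (- (Rabs (d_over d p - s) * INR T') - d_over d p * INR J - INR J / INR n).
  exists J, y; split=> //; split; first exact: Rpower_gt0.
  move=> i j k hh.
  have hy : y <= th j.
    apply: Rpower2_le; have hj := INR_leq (hit_scale hT hh); rewrite -/T' in hj.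
    have h1 := Rabs_pos (d_over d p - s); have h2 := Rle_abs (- (d_over d p - s)).
    rewrite Rabs_Ropp in h2; have h3 := INR_ge0 j.
    have : Rabs (d_over d p - s) * INR j <= Rabs (d_over d p - s) * INR T' by exact: Rmult_le_compat_l.
    by have := Rmult_le_compat_r _ _ _ h3 h2; lra.
  rewrite -/(th j); case: (c'P i j k) => [[_ ->]|[hP ->]].
    by rewrite Cmod_real; have := hth j; lra.
  case: (Rlt_le_dec (Cmod (c i j k)) (2 * th j)) => hlt; last by lra.
  by case: hP.
have [A hA] : exists A : nat -> R, forall j, level_val s p (coef_sub c' c) j (A j) /\
    (A j <= C * Rpower 2 (- (INR J / INR n)) /\ ((n * J + T < j)%N -> A j <= 0)).
  apply: (choice_fun (P := fun j a => level_val s p (coef_sub c' c) j a /\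
    (a <= C * Rpower 2 (- (INR J / INR n)) /\ ((n * J + T < j)%N -> a <= 0)))) => j.
  case: (ltnP (n * J + T) j) => hj.
    have [|||a [ha hab]] := level_val_small (s := s) (c := coef_sub c' c) (j := j) (b := 0) (l0 := [::]) hp _ _ _ hN.
    - by lra.
    - by move=> i k; rewrite diff0 ?c'_far //; lra.
    - by move=> i k _; rewrite diff0 ?c'_far.
    have ha0 : a <= 0.
      move: hab; case: (p) => [r|] //=.
      by rewrite Rmult_0_l [rpow 0 (/ r)]rpow_npos; lra.
    exists a; split=> //; split=> //.
    have : 0 < C * Rpower 2 (- (INR J / INR n)) by apply: Rmult_lt_0_compat => //; exact: Rpower_gt0.
    by lra.
  have [l [hls hl]] := hit_list L n J j.
  have [|||a [ha hab]] := level_val_small (s := s) (c := coef_sub c' c) (j := j)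
    (b := 4 * Rpower 2 (- (d_over d p * INR J) - INR J / INR n)) (l0 := l) hp _ _ _ hN.
  - by have := Rpower_gt0 2 (- (d_over d p * INR J) - INR J / INR n); lra.
  - move=> i k.
    have w0 := Rpower_gt0 2 ((s - d_over d p) * INR j).
    apply: Rle_trans (Rmult_le_compat_r _ _ _ (Rlt_le _ _ w0) (diff_le i j k)) _.
    rewrite Rmult_assoc -Rpower_plus; apply: Req_le; congr (_ * Rpower _ _); ring.
  - by move=> i k hin; apply: diff0; apply: c'_nhit => /hl.
  exists a; split=> //; split=> //; apply: Rle_trans hab _.
  by rewrite hls; exact: hsize.
have [B [hB hBe]] := hsmall A (fun j => proj1 (proj2 (hA j))) (fun j => proj2 (proj2 (hA j))).
have [v [hv hvB]] := bnorm_exists hq (fun j => proj1 (hA j)) hB.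
by exists v; split=> //; lra.
Qed.

End Generic.

(** * Divergence rates *)


Lemma big_Rplus_le (I : eqType) (l : seq I) (f : I -> R) i :
  (forall i, 0 <= f i) -> i \in l -> f i <= \big[Rplus/0]_(m <- l) f m.
Proof.
move=> h; elim: l => //= j l ih; rewrite inE big_cons.
have h2 : 0 <= \big[Rplus/0]_(m <- l) f m.
  by elim/big_ind: _ => [|x y|m _]; [lra | lra | exact: h].
by case/orP => [/eqP <-|/ih hi]; have := h j; lra.
Qed.

Lemma coord_le_enorm d (x : Rd d) m : Rabs (x m) <= enorm x.
Proof.
rewrite -sqrt_Rsqr_abs; apply: sqrt_le_1_alt.
rewrite /Rsqr; apply: (big_Rplus_le (f := fun m => x m * x m)); last by rewrite mem_index_enum.
by move=> i; nra.
Qed.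

Lemma enorm_le d (x : Rd d) b : 0 <= b -> (forall m, Rabs (x m) <= b) -> enorm x <= INR d * b.
Proof.
move=> hb h.
have h1 : Rsum (fun m => x m * x m) <= INR d * (b * b).
  rewrite /Rsum -[d in INR d]card_ord cardE enumT.
  have -> : index_enum ('I_d) = Finite.enum 'I_d by rewrite /index_enum unlock.
  elim: (Finite.enum _) => [|i l ih]; first by rewrite big_nil /=; lra.
  rewrite big_cons [size _]/= S_INR.
  have : x i * x i <= b * b.
    have := h i; have := Rabs_pos (x i).
    have <- : Rabs (x i) * Rabs (x i) = x i * x i by rewrite -Rabs_mult Rabs_right //; nra.
    by nra.
  by move=> hxx; rewrite Rmult_plus_distr_r Rmult_1_l Rplus_comm; exact: Rplus_le_compat.
have hd := INR_ge0 d.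
apply: (Rle_trans _ (sqrt ((INR d * b) * (INR d * b)))); last by rewrite sqrt_square; nra.
apply: sqrt_le_1_alt; apply: Rle_trans h1 _.
case: d x h hd => [|d] x h hd; first by rewrite /=; lra.
have : 1 <= INR d.+1 by apply: (INR_leq (m := 1)).
have : 0 <= b * b by nra.
move=> h2 h3; have : INR d.+1 * b * (INR d.+1 * b) = INR d.+1 * (INR d.+1 * (b * b)) by ring.
have := Rmult_le_pos _ _ hd h2.
by nra.
Qed.

Lemma coord_le_edist d (x y : Rd d) m : Rabs (x m - y m) <= edist x y.
Proof. exact: (coord_le_enorm (fun m => x m - y m)). Qed.

Lemma edist_le d (x y : Rd d) b : 0 <= b ->
  (forall m, Rabs (x m - y m) <= b) -> edist x y <= INR d * b.
Proof. exact: enorm_le. Qed.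

Section Rate.
Variables (d N : nat) (psi : 'I_N -> Rd d -> Cpx).
Implicit Types (c : coefs d N) (s : R) (p q : expo) (x : Rd d).

Definition rate c x g : Prop :=
  exists C, 0 < C /\
    exists (i : nat -> 'I_N) (j : nat -> nat) (k : nat -> Zd d),
      (forall M, exists n0, forall n, (n0 <= n)%nat -> (M <= j n)%nat) /\
      (forall n, Cmod (Cmul (c (i n) (j n) (k n)) (wav psi (i n) (j n) (k n) x))
                 >= C * Rpower 2 (g * INR (j n))).

Lemma div_expE c x delta : div_exp psi c x delta = is_lub (rate c x) delta.
Proof. by []. Qed.

Lemma rate_intro c x g C : 0 < C ->
  (forall n0, exists i j k, (n0 <= j)%N /\
     C * Rpower 2 (g * INR j) <= Cmod (Cmul (c i j k) (wav psi i j k x))) ->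
  rate c x g.
Proof.
move=> hC h.
have [f hf] := choice_fun (P := fun n0 (t : 'I_N * nat * Zd d) => (n0 <= t.1.2)%N /\
   C * Rpower 2 (g * INR t.1.2) <= Cmod (Cmul (c t.1.1 t.1.2 t.2) (wav psi t.1.1 t.1.2 t.2 x)))
   (fun n0 => let: ex_intro i (ex_intro j (ex_intro k hk)) := h n0 in ex_intro _ (i, j, k) hk).
exists C; split=> //; exists (fun n => (f n).1.1), (fun n => (f n).1.2), (fun n => (f n).2).
split; last by move=> n; apply: Rle_ge; case: (hf n).
by move=> M; exists M => n hn; case: (hf n); lia.
Qed.

Lemma rate_elim c x g : rate c x g -> exists C, 0 < C /\
  (forall n0, exists i j k, (n0 <= j)%N /\
     C * Rpower 2 (g * INR j) <= Cmod (Cmul (c i j k) (wav psi i j k x))).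
Proof.
move=> [C [hC [i [j [k [hj h]]]]]]; exists C; split=> // n0.
have [n1 hn1] := hj n0; exists (i n1), (j n1), (k n1); split; first exact: hn1.
exact: Rge_le.
Qed.

Lemma rate_le c x g g' : g' <= g -> rate c x g -> rate c x g'.
Proof.
move=> hg /rate_elim [C [hC h]]; apply: (rate_intro hC) => n0.
have [i [j [k [hj hh]]]] := h n0; exists i, j, k; split=> //.
apply: Rle_trans hh; apply: Rmult_le_compat_l; first lra.
by apply: Rpower2_le; have := INR_ge0 j; nra.
Qed.

Lemma Rpower2_bounded g B : (forall n0, exists j, (n0 <= j)%N /\ Rpower 2 (g * INR j) <= B) -> g <= 0.
Proof.
move=> h; case: (Rlt_le_dec 0 g) => // hg.
have [n hn] := nat_above ((2 * B + 1) / g).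
have [j [hj hB]] := h n.
have h1 : (2 * B + 1) / g <= INR j by have := INR_leq hj; lra.
have h2 : 2 * B + 1 <= g * INR j.
  have := Rmult_le_compat_l _ _ _ (Rlt_le _ _ hg) h1.
  by have -> : g * ((2 * B + 1) / g) = 2 * B + 1 by field; lra.
have h3 : 0 <= g * INR j by apply: Rmult_le_pos; [lra | exact: INR_ge0].
by have := Rpower2_ge_lin h3; lra.
Qed.

(** Coefficients are at most [V 2^((d/p - s) j)] and wavelets at most [M], so a rate [g] keeps
    [2^((g - d/p + s) j)] bounded along scales tending to infinity. *)
Lemma rate_ub s p q c x g : expo_pos p -> expo_pos q -> bounded_fun psi ->
  in_b s p q c -> rate c x g -> g <= d_over d p - s.
Proof.
move=> hp hq [M hM] hc /rate_elim [C [hC h]].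
have [V [hV hcV]] := in_b_coef hp hq hc.
set D := d_over d p.
suff : g - (D - s) <= 0 by lra.
apply: (@Rpower2_bounded _ (V * M / C)) => n0.
have [i [j [k [hj hh]]]] := h n0; exists j; split=> //.
have h1 := hM i (fun m => 2 ^ j * x m - IZR (k m)); have h2 := hcV i j k; rewrite -/D in h2.
have e : Rpower 2 ((g - (D - s)) * INR j) * Rpower 2 ((D - s) * INR j) = Rpower 2 (g * INR j).
  by rewrite -Rpower_plus; congr Rpower; ring.
have p1 := Rpower_gt0 2 ((D - s) * INR j).
have h3 : C * Rpower 2 (g * INR j) <= V * Rpower 2 ((D - s) * INR j) * M.
  apply: Rle_trans hh _; rewrite Cmod_mul; apply: Rmult_le_compat => //; exact: Cmod_ge0.
rewrite -e in h3.
have h4 : C * Rpower 2 ((g - (D - s)) * INR j) <= V * M.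
  apply: (Rmult_le_reg_r _ _ _ p1); lra.
apply: (Rmult_le_reg_l C) => //.
by have -> : C * (V * M / C) = V * M by field; lra.
Qed.

(** The covering property is applied to [y = 2^j0 (x - K 2^-J)], which lies in the unit cube.
    Undoing the scaling turns the wavelet found at [y] into one of scale [j0 + j_l] at [x], whose
    index satisfies [hit]. *)
Lemma cube_coef s p c L C0 n J j0 (K : Zd d) x :
  (forall x : Rd d, (forall m, 0 <= x m < 1) ->
      exists t, List.In t L /\ Cmod (wav psi t.1.1 t.1.2 t.2 x) >= C0) ->
  (forall i j k, hit L n J i j k -> thr d s p n J j <= Cmod (c i j k)) ->
  (J <= j0)%N -> (j0 <= n * J)%N -> 0 < C0 ->
  (forall m, Rabs (IZR (K m)) <= INR n * 2 ^ J) ->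
  (forall m, IZR (K m) / 2 ^ J <= x m < IZR (K m) / 2 ^ J + / 2 ^ j0) ->
  exists i j k, (j0 <= j)%N /\ C0 * thr d s p n J j <= Cmod (Cmul (c i j k) (wav psi i j k x)).
Proof.
move=> hcov hhit hJ hj hC0 hK hx.
pose y : Rd d := fun m => 2 ^ j0 * (x m - IZR (K m) / 2 ^ J).
have [|t [ht hw]] := hcov y.
  move=> m; have := hx m; have h2 := pow2_gt0 j0 => h1.
  split; first by apply: Rmult_le_pos; lra.
  apply: (Rmult_lt_reg_l (/ 2 ^ j0)); first exact: Rinv_0_lt_compat.
  by rewrite /y -Rmult_assoc Rinv_l; lra.
exists t.1.1, (j0 + t.1.2)%N, (fun m => (2 ^ Z.of_nat (t.1.2 + (j0 - J)) * K m + t.2 m)%Z).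
split; first by lia.
have -> : wav psi t.1.1 (j0 + t.1.2) (fun m => (2 ^ Z.of_nat (t.1.2 + (j0 - J)) * K m + t.2 m)%Z) x
    = wav psi t.1.1 t.1.2 t.2 y.
  rewrite /wav; congr psi; apply: functional_extensionality => m.
  rewrite plus_IZR mult_IZR -pow_IZR /y.
  have e : 2 ^ j0 = 2 ^ (j0 - J) * 2 ^ J by rewrite -Rdef_pow_add; congr (2 ^ _); lia.
  rewrite !Rdef_pow_add e; field; have := pow2_gt0 J; lra.
rewrite Cmod_mul Rmult_comm; apply: Rmult_le_compat; try lra.
- exact: Rlt_le (Rpower_gt0 _ _).
- by apply: hhit; exists t, j0, K.
Qed.

Definition sat_scales s p L (J : nat -> nat) c : Prop :=
  forall n, (n < J n)%N /\
    forall i j k, hit L n.+1 (J n) i j k -> thr d s p n.+1 (J n) j <= Cmod (c i j k).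

Lemma saturated_scales s p L c : (forall n, saturated s p L n.+1 c) ->
  exists J, sat_scales s p L J c.
Proof.
move=> h; apply: (choice_fun (P := fun n J => (n < J)%N /\
    forall i j k, hit L n.+1 J i j k -> thr d s p n.+1 J j <= Cmod (c i j k))) => n.
have [J [eta [hJ [he hh]]]] := h n; exists J; split=> // i j k /hh; lra.
Qed.

(* [theta] is the inverse of the approximation exponent of [x] by the corners. *)
Definition approx_by (J : nat -> nat) theta x : Prop :=
  forall n0, exists n j (K : Zd d), (n0 <= n)%N /\ (J n <= j)%N /\ (j <= n.+1 * J n)%N /\
    INR (J n) <= (theta + / INR n.+1) * INR j /\
    forall m, IZR (K m) / 2 ^ (J n) <= x m < IZR (K m) / 2 ^ (J n) + / 2 ^ j.

(** Since [J <= (theta + 1/(n+1)) j], the exponent in [thr] at scale [j'] is at least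
    [(D - s - D theta) j'] up to a loss of [(D + 2) j' / (n+1)], which the gap below
    [D - s - D theta] absorbs for large [n]. *)
Lemma rate_approx s p L J c theta x g : expo_pos p ->
  (exists C0, 0 < C0 /\ forall x : Rd d, (forall m, 0 <= x m < 1) ->
      exists t, List.In t L /\ Cmod (wav psi t.1.1 t.1.2 t.2 x) >= C0) ->
  sat_scales s p L J c -> 0 <= theta <= 1 -> approx_by J theta x ->
  g < d_over d p - s - d_over d p * theta -> rate c x g.
Proof.
move=> hp [C0 [hC0 hcov]] hJ hth hx hg.
set D := d_over d p in hg *.
have hD : 0 <= D by exact: d_over_ge0.
set e := D - s - D * theta - g.
have he : 0 < e by rewrite /e; lra.
apply: (rate_intro hC0) => n0.
(* [n1] brings the loss [(D + 2)/(n+1)] below [e]; [n2] puts the corner [K] of a cube containing [x]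
   into the box allowed by [hit]. *)
have [n1 hn1] := nat_above ((D + 2) / e).
have [n2 hn2] := nat_above (enorm x + 1).
have [n [j [K [hn [hj1 [hj2 [hjth hcube]]]]]]] := hx (n0 + n1 + n2)%N.
have [hnJ hhit] := hJ n.
have hn1' : (D + 2) / e <= INR n.+1 by apply: Rle_trans hn1 _; apply: INR_leq; lia.
have hn2' : enorm x + 1 <= INR n.+1 by apply: Rle_trans hn2 _; apply: INR_leq; lia.
have hn3 : 1 <= INR n.+1 by apply: (INR_leq (m := 1)).
have hK m : Rabs (IZR (K m)) <= INR n.+1 * 2 ^ (J n).
  have h1 := coord_le_enorm x m; have [h2 h3] := hcube m.
  have h4 := pow2_gt0 (J n).
  have h5 : / 2 ^ j <= 1.
    rewrite -[1]Rinv_1; apply: Rinv_le_contravar; [lra | exact: pow2_ge1].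
  have h6 : Rabs (IZR (K m) / 2 ^ (J n)) <= INR n.+1.
    by apply: Rabs_le; have := Rle_abs (x m); have := Rle_abs (- x m); rewrite Rabs_Ropp; lra.
  have -> : IZR (K m) = IZR (K m) / 2 ^ J n * 2 ^ J n by field; lra.
  rewrite Rabs_mult (Rabs_right (2 ^ J n)); last by lra.
  by apply: Rmult_le_compat_r; lra.
have [i [j' [k [hj' hc]]]] := cube_coef hcov hhit hj1 hj2 hC0 hK hcube.
exists i, j', k; split; first by lia.
apply: Rle_trans hc; apply: Rmult_le_compat_l; first by lra.
apply: Rpower2_le; rewrite -/D.
have hjj := INR_leq hj'; have hj0 := INR_ge0 j.
have hi0 : 0 < / INR n.+1 by apply: Rinv_0_lt_compat; lra.
have hi1 : / INR n.+1 <= 1 by rewrite -[1]Rinv_1; apply: Rinv_le_contravar; lra.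
have hie : (D + 2) * / INR n.+1 <= e.
  apply: (Rmult_le_reg_r (INR n.+1)); first by lra.
  rewrite Rmult_assoc Rinv_l; last by lra.
  have h7 := Rmult_le_compat_l _ _ _ (Rlt_le _ _ he) hn1'.
  have h8 : e * ((D + 2) / e) = D + 2 by field; lra.
  by lra.
have hJj : INR (J n) <= (theta + / INR n.+1) * INR j'.
  by apply: Rle_trans hjth _; apply: Rmult_le_compat_l; lra.
have h1 : D * INR (J n) <= D * ((theta + / INR n.+1) * INR j') by exact: Rmult_le_compat_l.
have h2 : INR (J n) / INR n.+1 <= 2 * / INR n.+1 * INR j'.
  rewrite /Rdiv; have : INR (J n) <= 2 * INR j'.
    by apply: Rle_trans hJj _; apply: Rmult_le_compat_r; lra.
  by move=> h; have := Rmult_le_compat_r _ _ _ (Rlt_le _ _ hi0) h; lra.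
have h3 : (D + 2) * / INR n.+1 * INR j' <= e * INR j' by apply: Rmult_le_compat_r; lra.
by rewrite /e in h3; lra.
Qed.

Lemma floor_cube (x : Rd d) (j : nat) : exists K : Zd d,
  forall m, IZR (K m) / 2 ^ j <= x m < IZR (K m) / 2 ^ j + / 2 ^ j.
Proof.
exists (fun m => Int_part (x m * 2 ^ j)) => m.
have [h1 h2] := base_Int_part (x m * 2 ^ j).
have h := pow2_gt0 j.
split; [apply: (Rmult_le_reg_r (2 ^ j)) | apply: (Rmult_lt_reg_r (2 ^ j))] => //.
  by rewrite /Rdiv Rmult_assoc Rinv_l; lra.
by rewrite Rmult_plus_distr_r /Rdiv Rmult_assoc Rinv_l; lra.
Qed.

Lemma approx_by_one (J : nat -> nat) x : approx_by J 1 x.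
Proof.
move=> n0; have [K hK] := floor_cube x (J n0).
exists n0, (J n0), K; split=> //; split=> //; split; first by lia.
split=> //.
have : 0 < / INR n0.+1 by apply: Rinv_0_lt_compat; apply: (lt_INR 0); lia.
by have := INR_ge0 (J n0); nra.
Qed.

End Rate.

(** * Hausdorff null sets *)


Lemma lsum_app (X : Type) (f : X -> R) l l' : lsum f (List.app l l') = lsum f l + lsum f l'.
Proof. by elim: l => [|x l ih] /=; [ring | rewrite ih; ring]. Qed.

Lemma lsum_map (X Y : Type) (f : Y -> R) (g : X -> Y) l :
  lsum f (List.map g l) = lsum (fun x => f (g x)) l.
Proof. by elim: l => //= x l ->. Qed.

Lemma lsum_incl (X : Type) (f : X -> R) l l' : (forall x, 0 <= f x) ->
  List.NoDup l -> List.incl l l' -> lsum f l <= lsum f l'.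
Proof.
move=> hf hl; elim: hl l' => [|x m hx hm ih] l' hincl; first exact: lsum_ge0.
have [l1 [l2 e]] := List.in_split x l' (hincl x (or_introl erefl)).
have := ih (List.app l1 l2).
rewrite e !lsum_app /= => h.
have : lsum f m <= lsum f l1 + lsum f l2.
  apply: h => y hy; have := hincl y (or_intror hy).
  rewrite e => hy'; apply/List.in_or_app.
  case: (List.in_app_or _ _ _ hy') => [|[exy|]]; [by left| |by right].
  by case: hx; rewrite exy.
by lra.
Qed.

Lemma lsum_seq (f : nat -> R) n : lsum f (List.seq 0 n.+1) = sum_f_R0 f n.
Proof.
elim: n => [|n ih]; first by rewrite /=; ring.
by rewrite List.seq_S lsum_app ih /=; ring.
Qed.

Lemma lsum_prod (X Y : Type) (f : X * Y -> R) l l' :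
  lsum f (List.list_prod l l') = lsum (fun x => lsum (fun y => f (x, y)) l') l.
Proof. by elim: l => //= x l ih; rewrite lsum_app lsum_map ih. Qed.

(** Finitely many pairs lie in a square, which is summed row by row. *)
Lemma sum_pairs_le (a : nat * nat -> R) (e : nat -> R) eps :
  (forall x, 0 <= a x) -> (forall m n, sum_f_R0 (fun i => a (m, i)) n <= e m) ->
  (forall n, sum_f_R0 e n <= eps) ->
  forall n, sum_f_R0 (fun k => a (Cantor.of_nat k)) n <= eps.
Proof.
move=> ha he heps n.
have [B hB] : exists B : nat, forall k, (k <= n)%N ->
    ((Cantor.of_nat k).1 <= B)%N /\ ((Cantor.of_nat k).2 <= B)%N.
  elim: n => [|n [B hB]].
    exists (maxn (Cantor.of_nat 0).1 (Cantor.of_nat 0).2) => k hk.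
    by have -> : k = 0%N by [lia]; lia.
  exists (B + (Cantor.of_nat n.+1).1 + (Cantor.of_nat n.+1).2)%N => k hk.
  have [->|hk'] : k = n.+1 \/ (k <= n)%N by lia.
    by lia.
  by have := hB k hk'; lia.
have -> : sum_f_R0 (fun k => a (Cantor.of_nat k)) n = lsum a (List.map Cantor.of_nat (List.seq 0 n.+1)).
  by rewrite lsum_map lsum_seq.
apply: (Rle_trans _ (lsum a (List.list_prod (List.seq 0 B.+1) (List.seq 0 B.+1)))).
  apply: lsum_incl => //.
    apply: List.NoDup_map_NoDup_ForallPairs; last exact: List.seq_NoDup.
    by move=> x y _ _ h; rewrite -(Cantor.cancel_to_of x) h Cantor.cancel_to_of.
  move=> x /List.in_map_iff [k [<-]] /List.in_seq hk.
  have [h1 h2] := hB k ltac:(lia).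
  case: (Cantor.of_nat k) h1 h2 => u v h1 h2; rewrite [(u, v).1]/= in h1; rewrite [(u, v).2]/= in h2.
  by apply: List.in_prod; apply/List.in_seq; lia.
rewrite lsum_prod lsum_seq.
apply: Rle_trans (heps B); apply: Rle_sum_f => k _.
by rewrite lsum_seq.
Qed.

Lemma sum_half_le eps n : 0 <= eps -> sum_f_R0 (fun m => eps * (/ 2) ^ m.+1) n <= eps.
Proof.
move=> he.
suff -> : sum_f_R0 (fun m => eps * (/ 2) ^ m.+1) n = eps * (1 - (/ 2) ^ n.+1).
  have : 0 < (/ 2) ^ n.+1 by apply: pow_lt; lra.
  by nra.
elim: n => [|n ih]; first by rewrite /=; field.
by rewrite [sum_f_R0 _ _]/= -/(sum_f_R0 _ n) ih /=; field.
Qed.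

Section Hausdorff.
Variable d : nat.
Implicit Types (E : Rd d -> Prop) (t : R).

Definition hcov t E eps : Prop :=
  exists (U : nat -> Rd d -> Prop) (r : nat -> R),
    (forall n, 0 < r n) /\
    (forall n x y, U n x -> U n y -> edist x y <= r n) /\
    (forall x, E x -> exists n, U n x) /\
    (forall n, sum_f_R0 (fun k => Rpower (r k) t) n <= eps).

Lemma hcov_mono t E E' eps eps' : (forall x, E' x -> E x) -> eps <= eps' ->
  hcov t E eps -> hcov t E' eps'.
Proof.
move=> hE he [U [r [h1 [h2 [h3 h4]]]]]; exists U, r; split=> //; split=> //.
by split=> [x /hE|n]; [exact: h3 | have := h4 n; lra].
Qed.

Lemma hcov_union t (E : nat -> Rd d -> Prop) (e : nat -> R) eps :
  (forall m, hcov t (E m) (e m)) -> (forall n, sum_f_R0 e n <= eps) ->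
  hcov t (fun x => exists m, E m x) eps.
Proof.
move=> h he.
have [F hF] := choice_fun (P := fun m (Ur : (nat -> Rd d -> Prop) * (nat -> R)) =>
    (forall n, 0 < Ur.2 n) /\
    (forall n x y, Ur.1 n x -> Ur.1 n y -> edist x y <= Ur.2 n) /\
    (forall x, E m x -> exists n, Ur.1 n x) /\
    (forall n, sum_f_R0 (fun k => Rpower (Ur.2 k) t) n <= e m))
   (fun m => let: ex_intro U (ex_intro r hk) := h m in ex_intro _ (U, r) hk).
exists (fun k => (F (Cantor.of_nat k).1).1 (Cantor.of_nat k).2),
       (fun k => (F (Cantor.of_nat k).1).2 (Cantor.of_nat k).2).
split; first by move=> n; case: (hF (Cantor.of_nat n).1) => h1 _; exact: h1.
split.
  by move=> n x y; case: (hF (Cantor.of_nat n).1) => _ [h2 _]; exact: h2.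
split.
  move=> x [m hm]; case: (hF m) => _ [_ [h3 _]]; have [n hn] := h3 x hm.
  by exists (Cantor.to_nat (m, n)); rewrite Cantor.cancel_of_to.
apply: (sum_pairs_le (a := fun mn => Rpower ((F mn.1).2 mn.2) t) (e := e)) => //.
  by move=> x; exact: Rlt_le (Rpower_gt0 _ _).
by move=> m n /=; case: (hF m) => _ [_ [_ h4]]; exact: h4.
Qed.

Lemma hausdorff_null_union t (E : nat -> Rd d -> Prop) :
  (forall m, hausdorff_null t (E m)) -> hausdorff_null t (fun x => exists m, E m x).
Proof.
move=> h eps he.
apply: (hcov_union (e := fun m => eps * (/ 2) ^ m.+1)).
  move=> m; apply: h; apply: Rmult_lt_0_compat => //; apply: pow_lt; lra.
by move=> n; apply: sum_half_le; lra.
Qed.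

Lemma hausdorff_null_mono t E E' : (forall x, E' x -> E x) ->
  hausdorff_null t E -> hausdorff_null t E'.
Proof. by move=> h hE eps he; apply: (hcov_mono (E := E) h (Rle_refl eps)); exact: hE. Qed.

(** Covers are sequences with positive radii, so the finite list is padded with empty sets whose
    radii have [t]-th powers of total at most [eta]. *)
Lemma hcov_list t (X : Type) (l : list X) (U : X -> Rd d -> Prop) r eta :
  0 < t -> 0 < r -> 0 < eta ->
  (forall a x y, U a x -> U a y -> edist x y <= r) ->
  hcov t (fun x => exists a, List.In a l /\ U a x) (INR (size l) * Rpower r t + eta).
Proof.
move=> ht hr heta hU.
pose V n x := exists a, List.nth_error l n = Some a /\ U a x.
pose rho n := if (n < size l)%N then r else Rpower (eta * (/ 2) ^ n.+1) (/ t).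
have hp n : 0 < eta * (/ 2) ^ n.+1 by apply: Rmult_lt_0_compat => //; apply: pow_lt; lra.
exists V, rho; split.
  by move=> n; rewrite /rho; case: ifP => // _; exact: Rpower_gt0.
split.
  move=> n x y [a [ha hx]] [b [hb hy]].
  have hn : (n < size l)%N.
    have : List.nth_error l n <> None by rewrite ha.
    by move/List.nth_error_Some => h; have : (n < size l)%coq_nat := h; lia.
  rewrite /rho hn; apply: hU hx _.
  by move: hb; rewrite ha => -[->].
split.
  move=> x [a [ha hx]]; have [n hn] := List.In_nth_error _ _ ha; exists n, a; split=> //.
move=> n.
have p1 := Rpower_gt0 r t.
apply: (Rle_trans _ (sum_f_R0 (fun k => (if (k < size l)%N then Rpower r t else 0) + eta * (/ 2) ^ k.+1) n)).
  apply: Rle_sum_f => k _; rewrite /rho; case: ifP => _.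
    by have := hp k; lra.
  by rewrite Rpower_mult Rinv_l ?Rpower_1 //; lra.
rewrite sum_plus; apply: Rplus_le_compat; last by apply: sum_half_le; lra.
case: (size l) => [|T].
  have -> : INR 0 * Rpower r t = 0 by rewrite /=; ring.
  by rewrite sum_eq_R0 //; lra.
apply: (@sum_f_le_support (fun k => if (k < T.+1)%N then Rpower r t else 0) (Rpower r t) T n) => [k|k hk|]; last by lra.
  by case: ifP => _; lra.
by case: ifP => h; [lia | lra].
Qed.

(** A set of diameter at most [r] lies in the box of side [2 r] centred at any of its points, whence
    the factor [2^d]; an empty set gets the origin as centre. *)
Lemma hausdorff_null_lebesgue E : (0 < d)%N -> hausdorff_null (INR d) E -> lebesgue_null E.
Proof.
move=> hd h eps he.
have h2d : 0 < 2 ^ d := pow2_gt0 d.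
have [U [r [h1 [h2 [h3 h4]]]]] := h (eps / 2 ^ d) (Rdiv_lt_0_compat _ _ he h2d).
have [u hu] : exists u : nat -> Rd d, forall n x, U n x -> U n (u n).
  apply: (choice_fun (P := fun n y => forall x, U n x -> U n y)) => n.
  case: (excluded_middle_informative (exists x, U n x)) => [[x hx]|hx]; first by exists x.
  by exists (fun=> 0) => x hxx; case: hx; exists x.
exists (fun n m => u n m - r n), (fun n m => u n m + r n); split.
  by move=> n m; have := h1 n; lra.
split.
  move=> x /h3 [n hn]; exists n => m.
  have h5 := coord_le_edist x (u n) m; have h6 := h2 n _ _ hn (hu _ _ hn).
  have := Rle_abs (x m - u n m); have := Rle_abs (- (x m - u n m)); rewrite Rabs_Ropp; lra.
move=> n.
have e k : Rprod (fun m : 'I_d => u k m + r k - (u k m - r k)) = Rpower (r k) (INR d) * 2 ^ d.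
  rewrite Rpower_pow // -Rpow_mult_distr /Rprod.
  have -> : \big[Rmult/1]_(m < d) (u k m + r k - (u k m - r k)) = \big[Rmult/1]_(m < d) (r k * 2).
    by apply: eq_bigr => m _; ring.
  by rewrite big_const card_ord; elim: (d) => //= m ->.
have -> : sum_f_R0 (fun k => Rprod (fun m : 'I_d => u k m + r k - (u k m - r k))) n
       = sum_f_R0 (fun k => Rpower (r k) (INR d)) n * 2 ^ d.
  rewrite [RHS]Rmult_comm scal_sum; apply: PartSum.sum_eq => k _; exact: e.
have := Rmult_le_compat_r _ _ _ (Rlt_le _ _ h2d) (h4 n).
by have -> : eps / 2 ^ d * 2 ^ d = eps by field; lra.
Qed.

End Hausdorff.

(** * Covering the points of large exponent *)

Lemma pow_le_inv a b n : (0 < n)%N -> 0 <= b -> a ^ n <= b ^ n -> 0 <= a -> a <= b.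
Proof.
move=> hn hb h ha; case: (Rlt_le_dec b a) => // hba.
case: n hn h => // n _ /= h.
have h1 : b ^ n <= a ^ n by apply: pow_incr; lra.
have h2 : 0 < a ^ n by apply: pow_lt; lra.
by have := pow_le b n hb; nra.
Qed.

(** A list that misses an element of [P] can be extended, so without an exhaustive one there would
    be lists of every length, against the bound. *)
Lemma exhaust_list (X : Type) (P : X -> Prop) B :
  (forall l, List.NoDup l -> (forall x, List.In x l -> P x) -> INR (size l) <= B) ->
  exists l, List.NoDup l /\ (forall x, List.In x l -> P x) /\ forall x, P x -> List.In x l.
Proof.
move=> h; have [n hn] := nat_above B.
suff : forall m, (exists l, List.NoDup l /\ (forall x, List.In x l -> P x) /\ forall x, P x -> List.In x l)
   \/ exists l, List.NoDup l /\ (forall x, List.In x l -> P x) /\ size l = m.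
  move/(_ n.+1) => [//|[l [h1 [h2 h3]]]].
  by have := h l h1 h2; rewrite h3 S_INR; lra.
elim=> [|m [ih|[l [h1 [h2 h3]]]]]; [|by left|].
  by right; exists [::]; split=> //; exact: List.NoDup_nil.
case: (excluded_middle_informative (forall x, P x -> List.In x l)) => hl.
  by left; exists l.
have [x [hx hxl]] : exists x, P x /\ ~ List.In x l.
  apply: Classical_Prop.NNPP => hne; apply: hl => x hx.
  by apply: Classical_Prop.NNPP => hin; apply: hne; exists x.
right; exists (x :: l); split; first by constructor.
by split; [move=> y [<-|/h2] | rewrite /= h3].
Qed.

Section UpperBound.
Variables (d N : nat) (psi : 'I_N -> Rd d -> Cpx).

(** At a point [x] of rate [g], for infinitely many [j] some coefficient of modulus at least
    [2^(g' j) / M] has its index [k] within [R0 2^(ep j)] of [2^j x], by fast decay. The space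
    allows [O(2^(a j))] such coefficients, so the [t]-th powers of the diameters at scale [j] add up
    to [O(2^(-kap j))], a convergent series. *)
Lemma rate_null s r q (c : coefs d N) t g : (0 < d)%N ->
  bounded_fun psi -> fast_decay psi -> 0 < r -> expo_pos q ->
  in_b s (EFin r) q c -> 0 < t -> INR d - s * r - g * r < t ->
  hausdorff_null t (fun x => rate psi c x g).
Proof.
move=> hd [M0 hM0] hdec hr hq hc ht htg.
have hd1 : 1 <= INR d by apply: (INR_leq (m := 1)).
set D := INR d / r.
have eDr : D * r = INR d by rewrite /D; field; lra.
pose M := Rabs M0 + 1.
have hM : 0 < M by rewrite /M; have := Rabs_pos M0; lra.
have hMb i x : Cmod (psi i x) <= M.
  by apply: Rle_trans (hM0 i x) _; rewrite /M; have := Rle_abs M0; lra.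
(* [g'] is chosen so that the counting exponent [a] is the midpoint of [d - s r - g r] and [t], that
   is [t - 2 kap]. *)
pose g' := g - (t - (INR d - s * r - g * r)) / (2 * r).
have hg' : g' < g.
  by rewrite /g'; have : 0 < (t - (INR d - s * r - g * r)) / (2 * r); [apply: Rdiv_lt_0_compat; lra | lra].
pose a := INR d - s * r - g' * r.
pose kap := (t - (INR d - s * r - g * r)) / 4.
have hkap : 0 < kap by rewrite /kap; lra.
have hak : a = t - 2 * kap by rewrite /a /g' /kap; field; lra.
(* Widening the cubes by [2^(ep j)] costs a factor [2^(kap j)] in the [t]-th powers, half of the
   available [2 kap]. *)
pose ep := kap / t.
have hep : 0 < ep by apply: Rdiv_lt_0_compat.
have hept : ep * t = kap by rewrite /ep; field; lra.
have hpc : expo_pos (EFin r) by [].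
have [V [hV hcV]] := in_b_coef hpc hq hc; rewrite [d_over _ _]/= -/D in hcV.
have [W [hW hcW]] := in_b_sum hr hq hc.
(* The decay order [n] makes [2^((D - s - g') j)] at most [2^(ep n j)]; the [n]-th root of the decay
   estimate then gives the radius [R0 2^(ep j)]. *)
have [n0 hn0] := nat_above ((D - s - g') / ep).
pose n := n0.+1.
have hn : D - s - g' <= ep * INR n.
  have h1 : (D - s - g') / ep <= INR n by apply: Rle_trans hn0 _; apply: INR_leq.
  have := Rmult_le_compat_l _ _ _ (Rlt_le _ _ hep) h1.
  by have -> : ep * ((D - s - g') / ep) = D - s - g' by field; lra.
have [Cn0 hCn0] := hdec n.
pose Cn := Rabs Cn0 + 1.
have hCn : 0 < Cn by rewrite /Cn; have := Rabs_pos Cn0; lra.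
have hnorm (x : Rd d) : 0 <= enorm x by exact: sqrt_pos.
have hpn (x : Rd d) : 0 < (1 + enorm x) ^ n by apply: pow_lt; have := hnorm x; lra.
have hdecay i x : Cmod (psi i x) * (1 + enorm x) ^ n <= Cn.
  have := Rmult_le_compat_r _ _ _ (Rlt_le _ _ (hpn x)) (hCn0 i x).
  rewrite /Rdiv Rmult_assoc Rinv_l; last by have := hpn x; lra.
  by rewrite /Cn; have := Rle_abs Cn0; lra.
pose R0 := 1 + V * Cn.
have hR0 : 1 <= R0 by rewrite /R0; have := Rmult_lt_0_compat _ _ hV hCn; lra.
pose near j (ik : 'I_N * Zd d) (x : Rd d) :=
  forall m, Rabs (2 ^ j * x m - IZR (ik.2 m)) <= R0 * Rpower 2 (ep * INR j).
pose big j (ik : 'I_N * Zd d) := Rpower 2 (g' * INR j) <= Cmod (c ik.1 j ik.2) * M.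
(* Chebyshev's argument: each large coefficient contributes at least [b] to a level sum bounded by
   [W]. *)
have hfin j l : List.NoDup l -> (forall x, List.In x l -> big j x) ->
    INR (size l) <= W * Rpower M r * Rpower 2 (a * INR j).
  move=> hl hlb.
  pose b := Rpower 2 (- (a * INR j)) * Rpower M (- r).
  have hb : forall x, List.In x l -> b <= wsum s r c j x.
    move=> x /hlb hx; rewrite /wsum.
    have h1 : Rpower 2 (g' * INR j) * / M <= Cmod (c x.1 j x.2).
      apply: (Rmult_le_reg_r M) => //; rewrite Rmult_assoc Rinv_l; last by lra.
      by rewrite Rmult_1_r.
    have w0 := Rpower_gt0 2 ((s - INR d / r) * INR j).
    have h2 := Rmult_le_compat_r _ _ _ (Rlt_le _ _ w0) h1.
    have := rpow_le hr h2.
    have him : 0 < / M by exact: Rinv_0_lt_compat.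
    have pg := Rpower_gt0 2 (g' * INR j).
    rewrite rpow_pos; last by do 2?apply: Rmult_lt_0_compat.
    rewrite -!Rpower_mult_distr //; last by apply: Rmult_lt_0_compat.
    rewrite !Rpower_mult; apply: Rle_trans; apply: Req_le.
    have -> : Rpower (/ M) r = Rpower M (- r) by rewrite /Rpower ln_Rinv //; congr exp; ring.
    have -> : Rpower 2 (g' * INR j * r) * Rpower M (- r) * Rpower 2 ((s - INR d / r) * INR j * r)
      = Rpower 2 (g' * INR j * r) * Rpower 2 ((s - INR d / r) * INR j * r) * Rpower M (- r) by ring.
    rewrite -Rpower_plus /b; congr (Rpower _ _ * _); rewrite /a; field; lra.
  have := Rle_trans _ _ _ (lsum_ge_const hb) (hcW j l hl).
  have hb0 : 0 < Rpower M r * Rpower 2 (a * INR j) by apply: Rmult_lt_0_compat; exact: Rpower_gt0.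
  move=> h; have := Rmult_le_compat_r _ _ _ (Rlt_le _ _ hb0) h.
  have -> : INR (size l) * b * (Rpower M r * Rpower 2 (a * INR j)) = INR (size l).
    rewrite /b !Rpower_Ropp; field; split; apply: Rgt_not_eq; exact: Rpower_gt0.
  by rewrite Rmult_assoc.
have [Lam hLam] : exists Lam : nat -> list ('I_N * Zd d), forall j,
    (forall x, big j x -> List.In x (Lam j)) /\ INR (size (Lam j)) <= W * Rpower M r * Rpower 2 (a * INR j).
  apply: (choice_fun (P := fun j l => (forall x, big j x -> List.In x l) /\
     INR (size l) <= W * Rpower M r * Rpower 2 (a * INR j))) => j.
  have [l [h1 [h2 h3]]] := exhaust_list (hfin j).
  by exists l; split=> //; exact: hfin.
pose E j x := exists ik, List.In ik (Lam j) /\ near j ik x.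
have hE x : rate psi c x g -> forall j0, exists j, (j0 <= j)%N /\ E j x.
  move=> /rate_elim [C [hC h]] j0.
  (* For [j >= n1] the factor [2^((g - g') j)] absorbs the constant [C] of the rate. *)
  have [n1 hn1] := nat_above (2 / (C * (g - g'))).
  have [i [j [k [hj hh]]]] := h (j0 + n1)%N.
  exists j; split; first by lia.
  have hgg : 0 < g - g' by lra.
  have hC1 : 1 <= C * Rpower 2 ((g - g') * INR j).
    have h1 : 2 / (C * (g - g')) <= INR j by apply: Rle_trans hn1 _; apply: INR_leq; lia.
    have hCg : 0 < C * (g - g') by apply: Rmult_lt_0_compat.
    have h2 := Rmult_le_compat_l _ _ _ (Rlt_le _ _ hCg) h1.
    have e2 : C * (g - g') * (2 / (C * (g - g'))) = 2 by field; lra.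
    have h3 : 0 <= (g - g') * INR j by apply: Rmult_le_pos; [lra | exact: INR_ge0].
    have := Rmult_le_compat_l _ _ _ (Rlt_le _ _ hC) (Rpower2_ge_lin h3).
    by lra.
  have hcp : Rpower 2 (g' * INR j) <= Cmod (c i j k) * Cmod (wav psi i j k x).
    rewrite -Cmod_mul; apply: Rle_trans hh.
    have -> : g * INR j = (g - g') * INR j + g' * INR j by ring.
    rewrite Rpower_plus -Rmult_assoc -[X in X <= _]Rmult_1_l.
    by apply: Rmult_le_compat_r; first exact: Rlt_le (Rpower_gt0 _ _).
  exists (i, k); split.
    apply: (proj1 (hLam j)); apply: Rle_trans hcp _.
    by apply: Rmult_le_compat_l; [exact: Cmod_ge0 | exact: hMb].
  pose y : Rd d := fun m => 2 ^ j * x m - IZR (k m).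
  have hy : 1 + enorm y <= R0 * Rpower 2 (ep * INR j).
    have hR0p : 0 <= R0 * Rpower 2 (ep * INR j).
      by apply: Rmult_le_pos; [lra | exact: Rlt_le (Rpower_gt0 _ _)].
    apply: (@pow_le_inv _ _ n) => //; last by have := hnorm y; lra.
    have h1 : Rpower 2 (g' * INR j) * (1 + enorm y) ^ n <= V * Rpower 2 ((D - s) * INR j) * Cn.
      apply: (Rle_trans _ (Cmod (c i j k) * Cmod (wav psi i j k x) * (1 + enorm y) ^ n)).
        by apply: Rmult_le_compat_r; [exact: Rlt_le | ].
      rewrite Rmult_assoc; apply: Rmult_le_compat; [exact: Cmod_ge0| |exact: hcV|exact: hdecay].
      by apply: Rmult_le_pos; [exact: Cmod_ge0 | exact: Rlt_le].
    have h2 : (1 + enorm y) ^ n <= V * Cn * Rpower 2 ((D - s - g') * INR j).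
      apply: (Rmult_le_reg_l (Rpower 2 (g' * INR j))); first exact: Rpower_gt0.
      apply: Rle_trans h1 _; apply: Req_le.
      have -> : (D - s) * INR j = g' * INR j + (D - s - g') * INR j by ring.
      by rewrite Rpower_plus; ring.
    apply: Rle_trans h2 _; rewrite Rpow_mult_distr.
    apply: Rmult_le_compat.
    - by apply: Rlt_le; apply: Rmult_lt_0_compat.
    - exact: Rlt_le (Rpower_gt0 _ _).
    - apply: (Rle_trans _ (R0 ^ 1)); first by rewrite pow_1 /R0; lra.
      by apply: Rle_pow => //; rewrite /n; lia.
    rewrite -Rpower_pow; last exact: Rpower_gt0.
    rewrite Rpower_mult; apply: Rpower2_le.
    by have := Rmult_le_compat_r _ _ _ (INR_ge0 j) hn; lra.
  by move=> m; have hm : Rabs (2 ^ j * x m - IZR (k m)) <= enorm y := coord_le_enorm y m; rewrite [(i, k).2]/=; lra.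
pose rr j := INR d * (2 * R0 * Rpower 2 (ep * INR j) * / 2 ^ j).
have hrr j : 0 < rr j.
  apply: Rmult_lt_0_compat; first by lra.
  apply: Rmult_lt_0_compat; last by apply: Rinv_0_lt_compat; exact: pow2_gt0.
  by apply: Rmult_lt_0_compat; [lra | exact: Rpower_gt0].
have hdiam j ik x y : near j ik x -> near j ik y -> edist x y <= rr j.
  move=> hx hy; have h2 := pow2_gt0 j.
  apply: edist_le.
    apply: Rlt_le; apply: Rmult_lt_0_compat; last exact: Rinv_0_lt_compat.
    by apply: Rmult_lt_0_compat; [lra | exact: Rpower_gt0].
  move=> m; apply: (Rmult_le_reg_r (2 ^ j)) => //.
  rewrite Rmult_assoc Rinv_l ?Rmult_1_r; last by lra.
  rewrite -{1}(Rabs_right (2 ^ j)); last by lra.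
  rewrite -Rabs_mult.
  have -> : (x m - y m) * 2 ^ j = (2 ^ j * x m - IZR (ik.2 m)) + - (2 ^ j * y m - IZR (ik.2 m)) by ring.
  apply: Rle_trans (Rabs_triang _ _) _; rewrite Rabs_Ropp.
  by have := hx m; have := hy m; lra.
pose Q := W * Rpower M r * Rpower (INR d * (2 * R0)) t + 1.
have hQ : 0 < Q.
  suff : 0 < W * Rpower M r * Rpower (INR d * (2 * R0)) t by rewrite /Q; lra.
  by apply: Rmult_lt_0_compat; [apply: Rmult_lt_0_compat => //|]; exact: Rpower_gt0.
have hcovE j : hcov t (E j) (Q * Rpower 2 (- kap * INR j)).
  have pk := Rpower_gt0 2 (- kap * INR j).
  have := hcov_list (Lam j) ht (hrr j) pk (hdiam j).
  apply: hcov_mono => //.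
  rewrite /Q Rmult_plus_distr_r Rmult_1_l; apply: Rplus_le_compat_r.
  have prt := Rpower_gt0 (rr j) t.
  apply: Rle_trans (Rmult_le_compat_r _ _ _ (Rlt_le _ _ prt) (proj2 (hLam j))) _.
  have -> : Rpower (rr j) t = Rpower (INR d * (2 * R0)) t * Rpower 2 ((ep * INR j - INR j) * t).
    have -> : rr j = (INR d * (2 * R0)) * Rpower 2 (ep * INR j - INR j).
      rewrite /rr /Rminus Rpower_plus Rpower_Ropp Rpower2_nat; ring.
    rewrite -Rpower_mult_distr; [by rewrite Rpower_mult | | exact: Rpower_gt0].
    by apply: Rmult_lt_0_compat; lra.
  apply: Req_le.
  transitivity (W * Rpower M r * Rpower (INR d * (2 * R0)) t * (Rpower 2 (a * INR j) * Rpower 2 ((ep * INR j - INR j) * t))).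
    by ring.
  rewrite -Rpower_plus; congr (_ * Rpower _ _).
  have -> : (ep * INR j - INR j) * t = (ep * t) * INR j - INR j * t by ring.
  by rewrite hept hak; ring.
(* Points of rate [g] lie in [E j] for arbitrarily large [j], hence in the union of the [E j] over
   [j >= j0]; [j0] is chosen so that the tail of the geometric series is below [eps]. *)
move=> eps heps.
pose x0 := Rpower 2 (- kap).
have hx0 : 0 < x0 < 1.
  split; first exact: Rpower_gt0.
  by rewrite /x0 -Rpower2_0; apply: Rpower2_lt; lra.
have [||j0 [_ hj0]] := @lin_exp_small kap 0 (Q / (1 - x0)) eps 0%N hkap _ _ heps; try lra.
  by apply: Rlt_le; apply: Rdiv_lt_0_compat; lra.
apply: (hcov_mono (E := fun x => exists m, E (j0 + m)%N x) (eps := eps)); last first.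
- apply: (hcov_union (fun m => hcovE (j0 + m)%N)) => m.
  have -> : sum_f_R0 (fun k => Q * Rpower 2 (- kap * INR (j0 + k))) m
     = Q * Rpower 2 (- kap * INR j0) * ((1 - x0 ^ m.+1) / (1 - x0)).
    rewrite -geom_sum; last by lra.
    rewrite scal_sum; apply: PartSum.sum_eq => k _.
    have -> : - kap * INR (j0 + k) = - kap * INR j0 + - kap * INR k by rewrite plus_INR; ring.
    rewrite Rpower_plus -(Rpower_mult 2 (- kap) (INR k)) -/x0 Rpower_pow; last by lra.
    by ring.
  have p1 : 0 < x0 ^ m.+1 by apply: pow_lt; lra.
  have p2 : 0 < Q * Rpower 2 (- kap * INR j0) by apply: Rmult_lt_0_compat => //; exact: Rpower_gt0.
  have p3 : (1 - x0 ^ m.+1) / (1 - x0) <= / (1 - x0).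
    rewrite -[X in _ <= X]Rmult_1_l; apply: Rmult_le_compat_r; last by lra.
    by apply: Rlt_le; apply: Rinv_0_lt_compat; lra.
  have := Rmult_le_compat_l _ _ _ (Rlt_le _ _ p2) p3.
  move: hj0; rewrite Rmult_0_l Rplus_0_l Ropp_mult_distr_l /Rdiv; lra.
- exact: Rle_refl.
by move=> x /hE /(_ j0) [j [hj hjE]]; exists (j - j0)%N; have -> : (j0 + (j - j0))%N = j by lia.
Qed.

End UpperBound.

(** * The unit cube is not null *)


Lemma nested_intervals (a b : nat -> R) :
  (forall n, a n <= a n.+1) -> (forall n, b n.+1 <= b n) -> (forall n, a n <= b n) ->
  exists x, forall n, a n <= x <= b n.
Proof.
move=> ha hb hab.
have ha' n k : a n <= a (n + k)%N.
  elim: k => [|k ih]; first by rewrite addn0; exact: Rle_refl.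
  by rewrite addnS; have := ha (n + k)%N; lra.
have hb' n k : b (n + k)%N <= b n.
  elim: k => [|k ih]; first by rewrite addn0; exact: Rle_refl.
  by rewrite addnS; have := hb (n + k)%N; lra.
have hc m n : a m <= b n.
  have := ha' m n; have := hb' n m; have := hab (m + n)%N; rewrite (addnC n m); lra.
have [||x hx] := completeness (fun u => exists n, u = a n).
- by exists (b 0%N) => u [n ->].
- by exists (a 0%N), 0%N.
exists x => n; case: hx => h1 h2; split; first by apply: h1; exists n.
by apply: h2 => u [k ->].
Qed.

Lemma small_pow2 r : 0 < r -> exists l : nat, / 2 ^ l < r.
Proof.
move=> hr; have [n hn] := nat_above (4 / r).
exists n; rewrite -[r]Rinv_inv.
apply: Rinv_lt_contravar.
  by apply: Rmult_lt_0_compat; [exact: Rinv_0_lt_compat | exact: pow2_gt0].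
have := Rpower2_ge_lin (INR_ge0 n); rewrite Rpower2_nat => h.
have : 0 < / r by exact: Rinv_0_lt_compat.
by rewrite /Rdiv in hn; lra.
Qed.

Definition in_cube d l (K : 'I_d -> nat) (y : Rd d) : Prop :=
  forall m, INR (K m) / 2 ^ l <= y m <= (INR (K m) + 1) / 2 ^ l.

Lemma cube_child d l (K : 'I_d -> nat) (y : Rd d) : in_cube l K y ->
  exists u : {ffun 'I_d -> bool}, in_cube l.+1 (fun m => (2 * K m + u m)%N) y.
Proof.
move=> hy.
exists [ffun m => if Rle_dec ((2 * INR (K m) + 1) / 2 ^ l.+1) (y m) then true else false] => m.
have [h1 h2] := hy m; have p := pow2_gt0 l.
have e : 2 ^ l.+1 = 2 * 2 ^ l by [].
have e1 : INR (K m) / 2 ^ l = (2 * INR (K m)) / 2 ^ l.+1 by rewrite e; field; lra.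
have e2 : (INR (K m) + 1) / 2 ^ l = (2 * INR (K m) + 2) / 2 ^ l.+1 by rewrite e; field; lra.
rewrite ffunE plus_INR mult_INR; case: Rle_dec => h /=.
  split; first by move: h; rewrite /=; lra.
  have -> : (1 + 1) * INR (K m) + 1 + 1 = 2 * INR (K m) + 2 by ring.
  by move: h2; rewrite e2.
split; first by move: h1; rewrite e1 /= Rplus_0_r.
have -> : (1 + 1) * INR (K m) + 0 + 1 = 2 * INR (K m) + 1 by ring.
by move: h; rewrite /=; lra.
Qed.

(* Heine-Borel by repeated subdivision: a cube without finite subcover would
   contain a nested sequence of such cubes. *)
Lemma cube_compact d (V : nat -> Rd d -> Prop) (W : nat -> Rd d -> Prop) (r : nat -> R)
    l0 (K0 : 'I_d -> nat) :
  (forall k, 0 < r k) ->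
  (forall k x y, W k x -> (forall m, Rabs (y m - x m) < r k) -> V k y) ->
  (forall x, in_cube l0 K0 x -> exists k, W k x) ->
  exists M : nat, forall x, in_cube l0 K0 x -> exists k, (k <= M)%N /\ V k x.
Proof.
move=> hr hV hcov; apply: Classical_Prop.NNPP => hno.
pose bad l K := ~ exists M : nat, forall x : Rd d, in_cube l K x -> exists k, (k <= M)%N /\ V k x.
have step (lK : nat * ('I_d -> nat)) : exists u : {ffun 'I_d -> bool},
    bad lK.1 lK.2 -> bad lK.1.+1 (fun m => (2 * lK.2 m + u m)%N).
  case: lK => l K /=; apply: Classical_Prop.NNPP => hu.
  have hall (u : {ffun 'I_d -> bool}) : exists M : nat, forall x : Rd d,
      in_cube l.+1 (fun m => (2 * K m + u m)%N) x -> exists k, (k <= M)%N /\ V k x.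
    by apply: Classical_Prop.NNPP => hb; apply: hu; exists u.
  have [M hM] := choice_fun hall.
  apply: hu; exists [ffun=> true] => hbad; case: hbad.
  exists (\max_(u : {ffun 'I_d -> bool}) M u)%N => x /cube_child [u hu].
  have [k [hk hk']] := hM u x hu; exists k; split=> //.
  by apply: leq_trans hk _; exact: leq_bigmax.
have [F hF] := choice_fun step.
pose Ks := fix Ks n := match n with 0%N => K0 | n'.+1 => fun m => (2 * Ks n' m + F ((l0 + n')%N, Ks n') m)%N end.
have KsS n m : Ks n.+1 m = (2 * Ks n m + F ((l0 + n)%N, Ks n) m)%N by [].
have hbad n : bad (l0 + n)%N (Ks n).
  elim: n => [|n ih]; first by rewrite addn0.
  by rewrite addnS; exact: (hF ((l0 + n)%N, Ks n) ih).
have hx m : exists x, forall n, INR (Ks n m) / 2 ^ (l0 + n) <= x <= (INR (Ks n m) + 1) / 2 ^ (l0 + n).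
  apply: (nested_intervals (a := fun n => INR (Ks n m) / 2 ^ (l0 + n))
      (b := fun n => (INR (Ks n m) + 1) / 2 ^ (l0 + n))) => n.
  - have p := pow2_gt0 (l0 + n); rewrite addnS.
    have -> : INR (Ks n m) / 2 ^ (l0 + n) = (2 * INR (Ks n m)) / 2 ^ (l0 + n).+1 by rewrite -tech_pow_Rmult; field; lra.
    apply: Rmult_le_compat_r; first by apply: Rlt_le; apply: Rinv_0_lt_compat; exact: pow2_gt0.
    rewrite KsS plus_INR mult_INR.
    by have := INR_ge0 (F ((l0 + n)%N, Ks n) m); rewrite [INR 2]/=; lra.
  - have p := pow2_gt0 (l0 + n); rewrite addnS.
    have -> : (INR (Ks n m) + 1) / 2 ^ (l0 + n) = (2 * INR (Ks n m) + 2) / 2 ^ (l0 + n).+1 by rewrite -tech_pow_Rmult; field; lra.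
    apply: Rmult_le_compat_r; first by apply: Rlt_le; apply: Rinv_0_lt_compat; exact: pow2_gt0.
    rewrite KsS plus_INR mult_INR.
    have : INR (F ((l0 + n)%N, Ks n) m) <= 1 by case: (F _ m); rewrite /=; lra.
    by rewrite [INR 2]/=; lra.
  apply: Rmult_le_compat_r; first by apply: Rlt_le; apply: Rinv_0_lt_compat; exact: pow2_gt0.
  by lra.
have [x hxx] := choice_fun hx.
have [|k hk] := hcov x.
  by move=> m; have := hxx m 0%N; rewrite addn0.
have [l hl] := small_pow2 (hr k).
apply: (hbad l); exists k => y hy; exists k; split=> //; apply: hV hk _ => m.
have h1 := hxx m l; have h2 := hy m.
have e : (INR (Ks l m) + 1) / 2 ^ (l0 + l) = INR (Ks l m) / 2 ^ (l0 + l) + / 2 ^ (l0 + l).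
  by field; have := pow2_gt0 (l0 + l); lra.
have h3 : / 2 ^ (l0 + l) <= / 2 ^ l.
  apply: Rinv_le_contravar; first exact: pow2_gt0.
  by apply: Rle_pow; [lra | lia].
by apply: Rle_lt_trans hl; apply: Rabs_le; rewrite e in h1 h2; lra.
Qed.

Lemma INR_sum (n : nat) (F : 'I_n.+1 -> nat) (G : nat -> R) :
  (forall k, INR (F k) <= G k) -> INR (\sum_(k < n.+1) F k)%N <= sum_f_R0 G n.
Proof.
elim: n F => [|n ih] F h; first by rewrite big_ord1; exact: h.
rewrite big_ord_recr plus_INR /=; apply: Rplus_le_compat; last exact: h.
by apply: ih => k; exact: (h (widen_ord (leqnSn n.+1) k)).
Qed.

(** Differences with a fixed [g] in [A], shifted by [n], inject [A] into functions with [2 n + 1]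
    values; [n <= rho + 1] and [3 <= rho] make this at most [3 rho] per coordinate. *)
Lemma card_close d P (A : {set {ffun 'I_d -> 'I_P}}) rho :
  3 <= rho -> (forall f g, f \in A -> g \in A -> forall m, Rabs (INR (f m) - INR (g m)) <= rho) ->
  INR #|A| <= (3 * rho) ^ d.
Proof.
move=> hrho h.
case: (set_0Vmem A) => [->|[g hg]].
  by rewrite cards0; apply: pow_le; lra.
have [n [hn1 hn2]] := nat_ceil (x := rho) ltac:(lra).
have hfg f m : f \in A -> (g m <= f m + n)%N /\ (f m <= g m + n)%N.
  move=> hf; have h1 : Rabs (INR (f m) - INR (g m)) <= INR n by have := h f g hf hg m; lra.
  have := Rle_abs (INR (f m) - INR (g m)); have := Rle_abs (- (INR (f m) - INR (g m))).
  rewrite Rabs_Ropp => h2 h3.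
  by split; apply/leP; apply: INR_le; rewrite plus_INR; lra.
pose s (f : {ffun 'I_d -> 'I_P}) : {ffun 'I_d -> 'I_((2 * n).+1)} := [ffun m => inord (f m + n - g m)].
have inj : {in A &, injective s}.
  move=> f1 f2 h1 h2 /ffunP e; apply/ffunP => m; apply: val_inj => /=.
  have := e m; rewrite !ffunE => /(congr1 val) /=.
  have [a1 a2] := hfg f1 m h1; have [b1 b2] := hfg f2 m h2.
  move: a1 a2 b1 b2; move: (nat_of_ord (f1 m)) (nat_of_ord (f2 m)) (nat_of_ord (g m)) => x y z a1 a2 b1 b2.
  by rewrite !inordK; lia.
have hc : (#|A| <= (2 * n).+1 ^ d)%N.
  rewrite -(card_in_imset inj); apply: leq_trans (max_card _) _.
  by rewrite card_ffun !card_ord.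
apply: Rle_trans (INR_leq hc) _; rewrite INR_expn S_INR mult_INR.
apply: pow_incr; have := INR_ge0 n; rewrite [INR 2]/=; lra.
Qed.

(** The sets of a cover are enlarged to neighbourhoods, finitely many of which suffice by
    compactness. Of the [2^(L d)] grid points of mesh [2^-(L+1)], the [k]-th neighbourhood contains
    at most [(18 r_k 2^L)^d], so the sum of the [r_k^d] is at least [18^-d], twice what the cover
    allows. *)
Lemma cube_not_null d : (0 < d)%N ->
  ~ hausdorff_null (INR d) (fun x : Rd d => forall m, 0 <= x m <= / 2).
Proof.
move=> hd hnull.
have h18 : 0 < 18 ^ d by apply: pow_lt; lra.
have [U [r [hr [hdiam [hcov hsum]]]]] := hnull (/ (2 * 18 ^ d)) ltac:(apply: Rinv_0_lt_compat; lra).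
pose V k (y : Rd d) := exists u, U k u /\ forall m, Rabs (y m - u m) < r k.
have hcube (x : Rd d) : in_cube 1 (fun=> 0%N) x <-> forall m, 0 <= x m <= / 2.
  by split=> h m; have := h m; rewrite /= Rmult_1_r /Rdiv; lra.
have [M hM] : exists M : nat, forall x : Rd d, in_cube 1 (fun=> 0%N) x -> exists k, (k <= M)%N /\ V k x.
  apply: (cube_compact (W := U) hr); first by move=> k x y hx hxy; exists x.
  by move=> x /hcube; exact: hcov.
(* The mesh is finer than all the radii retained, so that the hypothesis [3 <= rho] of [card_close]
   holds. *)
have [L hL] : exists L : nat, forall k, (k <= M)%N -> / 2 ^ L <= r k.
  elim: (M) => [|M' [L hL]].
    have [l hl] := small_pow2 (hr 0%N); exists l => k hk.
    by have -> : k = 0%N by [lia]; lra.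
  have [l hl] := small_pow2 (hr M'.+1); exists (l + L)%N => k hk.
  have e : / 2 ^ (l + L) <= / 2 ^ l /\ / 2 ^ (l + L) <= / 2 ^ L.
    by split; (apply: Rinv_le_contravar; [exact: pow2_gt0 | apply: Rle_pow; [lra | lia]]).
  have [->|hk'] : k = M'.+1 \/ (k <= M')%N by lia.
    by lra.
  by have := hL k hk'; lra.
pose T := {ffun 'I_d -> 'I_(2 ^ L)}.
pose pt (f : T) : Rd d := fun m => INR (f m) / 2 ^ L.+1.
have pL := pow2_gt0 L; have pL1 := pow2_gt0 L.+1.
have hpt f : exists k : 'I_M.+1, V k (pt f).
  have [|k [hk hk']] := hM (pt f); last by exists (Ordinal (hk : (k < M.+1)%N)).
  apply/hcube => m; rewrite /pt.
  have h1 := ltn_ord (f m); have h2 := INR_leq (ltnW h1); rewrite INR_expn (INR_IZR_INZ 2) in h2.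
  have h3 := INR_ge0 (f m).
  split; first by apply: Rmult_le_pos => //; apply: Rlt_le; exact: Rinv_0_lt_compat.
  apply: (Rmult_le_reg_r (2 ^ L.+1)) => //.
  rewrite /Rdiv Rmult_assoc Rinv_l; last by lra.
  by rewrite -tech_pow_Rmult; move: h2 => /=; lra.
have [kap hkap] := choice_fun hpt.
have hcard : #|T| = (\sum_(k < M.+1) #|[set f : T | kap f == k]|)%N.
  rewrite -sum1_card (partition_big kap predT) //=; apply: eq_bigr => k _.
  by rewrite -sum1_card; apply: eq_bigl => f; rewrite inE.
have hk (k : 'I_M.+1) : INR #|[set f : T | kap f == k]| <= (3 * (3 * r k * 2 ^ L.+1)) ^ d.
  apply: card_close.
    have h1 := hL k (ltn_ord k : (k <= M)%N).
    have := Rmult_le_compat_r _ _ _ (Rlt_le _ _ pL) h1; rewrite Rinv_l; last by lra.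
    by rewrite -tech_pow_Rmult; lra.
  move=> f g; rewrite !inE => /eqP hf /eqP hg m.
  have [u [hu hfu]] := hkap f; have [v [hv hgv]] := hkap g; rewrite hf in hu hfu; rewrite hg in hv hgv.
  have h1 := coord_le_edist u v m; have h2 := hdiam k u v hu hv.
  have h3 : Rabs (pt f m - pt g m) <= 3 * r k.
    have -> : pt f m - pt g m = (pt f m - u m) + ((u m - v m) + - (pt g m - v m)) by ring.
    apply: Rle_trans (Rabs_triang _ _) _.
    have := Rabs_triang (u m - v m) (- (pt g m - v m)); rewrite Rabs_Ropp.
    by have := hfu m; have := hgv m; lra.
  have -> : INR (f m) - INR (g m) = (pt f m - pt g m) * 2 ^ L.+1.
    by rewrite /pt; move: (INR (f m)) (INR (g m)) (2 ^ L.+1) pL1 => a b z hz; field; lra.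
  by rewrite Rabs_mult (Rabs_right (2 ^ L.+1)); [apply: Rmult_le_compat_r | ]; lra.
have hT : INR #|T| = (2 ^ L) ^ d by rewrite card_ffun !card_ord !INR_expn (INR_IZR_INZ 2).
have h1 := INR_sum (G := fun k => (3 * (3 * r k * 2 ^ L.+1)) ^ d) hk.
rewrite -hcard hT in h1.
have e : sum_f_R0 (fun k => (3 * (3 * r k * 2 ^ L.+1)) ^ d) M
   = 18 ^ d * (2 ^ L) ^ d * sum_f_R0 (fun k => Rpower (r k) (INR d)) M.
  rewrite scal_sum; apply: PartSum.sum_eq => k _; rewrite Rpower_pow // -!Rpow_mult_distr.
  by congr (_ ^ _); rewrite -tech_pow_Rmult; ring.
rewrite e in h1.
have p1 : 0 < (2 ^ L) ^ d by exact: pow_lt.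
have p2 : 0 < 18 ^ d * (2 ^ L) ^ d by exact: Rmult_lt_0_compat.
have := Rmult_le_compat_l _ _ _ (Rlt_le _ _ p2) (hsum M).
have -> : 18 ^ d * (2 ^ L) ^ d * / (2 * 18 ^ d) = (2 ^ L) ^ d / 2 by field; lra.
by lra.
Qed.

(** * Cantor sets *)


(* Level [i+1] of the construction keeps, in an interval of length [2^-(j i)],
   the intervals of length [2^-(j (i+1))] at the points [K 2^-(J (i+1))] of its
   lower half, that is [2^(J (i+1) - j i - 1)] of them; [depth] adds up the
   exponents. *)
Fixpoint depth (J j : nat -> nat) (i : nat) : nat :=
  match i with
  | 0%N => 0%N
  | i'.+1 => (depth J j i' + (J i'.+1 - j i' - 1))%N
  end.

(** For [a] in [[0, 1)], the integer written by the first [depth J j i] binary digits of [a]. *)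
Definition vdig (J j : nat -> nat) (a : R) (i : nat) : Z := Int_part (a * 2 ^ depth J j i).

(** Numerator over [2^(J i)] of the left end of the level [i] interval with parameter [a]: the
    previous corner is rewritten on the finer grid and moved by the number that the new block of
    digits of [a] forms. *)
Fixpoint corner (J j : nat -> nat) (K0 : Z) (a : R) (i : nat) : Z :=
  match i with
  | 0%N => K0
  | i'.+1 => (2 ^ Z.of_nat (J i'.+1 - J i') * corner J j K0 a i' +
      (vdig J j a i'.+1 - 2 ^ Z.of_nat (depth J j i'.+1 - depth J j i') * vdig J j a i'))%Z
  end.

(** The [2] leaves at least one new binary digit per level after the upper half of the interval is
    given up. *)
Definition cantor_levels (J j : nat -> nat) := forall i, (J i <= j i)%N /\ (j i + 2 <= J i.+1)%N.

Lemma Int_part_bounds x : IZR (Int_part x) <= x < IZR (Int_part x) + 1.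
Proof. by have := base_Int_part x; lra. Qed.

Lemma Int_part_le x y : x <= y -> (Int_part x <= Int_part y)%Z.
Proof.
move=> h; have := Int_part_bounds x; have := Int_part_bounds y => h1 h2.
suff : (Int_part x < Int_part y + 1)%Z by lia.
by apply: lt_IZR; rewrite plus_IZR; lra.
Qed.

Lemma IZR_pow2 n : IZR (2 ^ Z.of_nat n) = 2 ^ n.
Proof. by rewrite -pow_IZR. Qed.

Section Digits.
Variables (J j : nat -> nat).
Hypothesis lev : cantor_levels J j.

Lemma depth_ge i : (i <= depth J j i)%N.
Proof. by elim: i => //= i ih; have := lev i; lia. Qed.

Lemma digit_bounds a i :
  (0 <= vdig J j a i.+1 - 2 ^ Z.of_nat (depth J j i.+1 - depth J j i) * vdig J j a i
     < 2 ^ Z.of_nat (J i.+1 - j i - 1))%Z.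
Proof.
have e : (depth J j i.+1 - depth J j i = J i.+1 - j i - 1)%N by rewrite /=; lia.
rewrite e /vdig; set k := (J i.+1 - j i - 1)%N.
have -> : a * 2 ^ depth J j i.+1 = a * 2 ^ depth J j i * 2 ^ k.
  by rewrite [depth _ _ _]/= -/k Rdef_pow_add; ring.
set x := a * 2 ^ depth J j i.
have h1 := Int_part_bounds x; have h2 := Int_part_bounds (x * 2 ^ k); have p := pow2_gt0 k.
have e2 := IZR_pow2 k.
have h3 : IZR (2 ^ Z.of_nat k * Int_part x) < IZR (Int_part (x * 2 ^ k) + 1).
  by rewrite mult_IZR plus_IZR e2; nra.
have h4 : IZR (Int_part (x * 2 ^ k)) < IZR (2 ^ Z.of_nat k * (Int_part x + 1)).
  by rewrite mult_IZR plus_IZR e2; nra.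
by move: (lt_IZR _ _ h3) (lt_IZR _ _ h4); lia.
Qed.

(** The new block of digits is less than [2^(J i.+1 - j i - 1)], so even its last grid step ends
    within the lower half of the previous interval. *)
Lemma corner_step K0 a i :
  let y i := IZR (corner J j K0 a i) / 2 ^ J i in
  y i <= y i.+1 /\ y i.+1 + / 2 ^ J i.+1 <= y i + / 2 ^ (j i).+1.
Proof.
move=> y; have [h1 h2] := digit_bounds a i; have [l1 l2] := lev i.
pose u := (vdig J j a i.+1 - 2 ^ Z.of_nat (depth J j i.+1 - depth J j i) * vdig J j a i)%Z.
rewrite -/u in h1 h2.
have hu : IZR u + 1 <= 2 ^ (J i.+1 - j i - 1).
  by rewrite -IZR_pow2 -plus_IZR; apply: IZR_le; lia.
have hu0 : 0 <= IZR u by apply: IZR_le.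
have p := pow2_gt0 (J i.+1).
have e : y i.+1 = y i + IZR u / 2 ^ J i.+1.
  rewrite /y [corner _ _ _ _ i.+1]/= -/u plus_IZR mult_IZR IZR_pow2.
  have -> : 2 ^ J i.+1 = 2 ^ (J i.+1 - J i) * 2 ^ J i by rewrite -Rdef_pow_add; congr (2 ^ _); lia.
  by field; split; apply: Rgt_not_eq; exact: pow2_gt0.
rewrite e; split.
  have : 0 <= IZR u / 2 ^ J i.+1 by apply: Rmult_le_pos => //; apply: Rlt_le; exact: Rinv_0_lt_compat.
  by lra.
have e2 : / 2 ^ (j i).+1 = 2 ^ (J i.+1 - j i - 1) / 2 ^ J i.+1.
  have -> : 2 ^ J i.+1 = 2 ^ (J i.+1 - j i - 1) * 2 ^ (j i).+1 by rewrite -Rdef_pow_add; congr (2 ^ _); lia.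
  by field; split; apply: Rgt_not_eq; exact: pow2_gt0.
have : (IZR u + 1) / 2 ^ J i.+1 <= / 2 ^ (j i).+1.
  by rewrite e2; apply: Rmult_le_compat_r => //; apply: Rlt_le; exact: Rinv_0_lt_compat.
by rewrite /Rdiv Rmult_plus_distr_r; lra.
Qed.

(** Staying in the closed lower halves, of length [2^-(j i + 1)], keeps the point off the right end
    of the half-open intervals of length [2^-(j i)]. *)
Definition bracket K0 a x := forall i,
  IZR (corner J j K0 a i) / 2 ^ J i <= x <= IZR (corner J j K0 a i) / 2 ^ J i + / 2 ^ (j i).+1.

Lemma corner_limit K0 a : exists x, bracket K0 a x.
Proof.
apply: (nested_intervals (a := fun i => IZR (corner J j K0 a i) / 2 ^ J i)
  (b := fun i => IZR (corner J j K0 a i) / 2 ^ J i + / 2 ^ (j i).+1)) => i.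
- by case: (corner_step K0 a i).
- have [_ h] := corner_step K0 a i; have [l1 _] := lev i.+1.
  have : / 2 ^ (j i.+1).+1 <= / 2 ^ J i.+1.
    by apply: Rinv_le_contravar; [exact: pow2_gt0 | apply: Rle_pow; [lra | lia]].
  by lra.
by have := Rinv_0_lt_compat _ (pow2_gt0 (j i).+1); lra.
Qed.

(** If all blocks agreed, [a] and [b] would share arbitrarily many binary digits. Monotonicity of
    the integer part gives the sign of the first disagreement. *)
Lemma first_difference (a b : R) : 0 <= a < b -> b < 1 -> exists i,
  (forall k, (k <= i)%N -> vdig J j a k = vdig J j b k) /\ (vdig J j a i.+1 < vdig J j b i.+1)%Z.
Proof.
move=> hab hb1; apply: Classical_Prop.NNPP => hno.
have hle i : (vdig J j a i <= vdig J j b i)%Z.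
  apply: Int_part_le; apply: Rmult_le_compat_r; [exact: Rlt_le (pow2_gt0 _) | lra].
have heq i : forall k, (k <= i)%N -> vdig J j a k = vdig J j b k.
  elim: i => [|i ih] k hk.
    have -> : k = 0%N by lia.
    rewrite /vdig /= !Rmult_1_r.
    have h1 := Int_part_bounds a; have h2 := Int_part_bounds b.
    have [a1 a2] : (Int_part a < 1)%Z /\ (-1 < Int_part a)%Z by split; apply: lt_IZR; lra.
    have [b1 b2] : (Int_part b < 1)%Z /\ (-1 < Int_part b)%Z by split; apply: lt_IZR; lra.
    by lia.
  have [->|hk'] : k = i.+1 \/ (k <= i)%N by lia.
    case: (Z.eq_dec (vdig J j a i.+1) (vdig J j b i.+1)) => // hne; case: hno.
    by exists i; split=> //; have := hle i.+1; lia.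
  exact: ih.
have [l hl] := @small_pow2 (b - a) ltac:(lra).
have h1 := Int_part_bounds (a * 2 ^ depth J j l).
have h2 := Int_part_bounds (b * 2 ^ depth J j l).
have := heq l l (leqnn l); rewrite /vdig => e; rewrite e in h1.
have p := pow2_gt0 (depth J j l).
have h3 : (b - a) * 2 ^ depth J j l < 1 by lra.
have h4 : 2 ^ l <= 2 ^ depth J j l by apply: Rle_pow; [lra | have := depth_ge l; lia].
have h5 : 1 < (b - a) * 2 ^ l.
  have := Rmult_lt_compat_r _ _ _ (pow2_gt0 l) hl; rewrite Rinv_l //.
  by have := pow2_gt0 l; lra.
have : (b - a) * 2 ^ l <= (b - a) * 2 ^ depth J j l by apply: Rmult_le_compat_l; lra.
by lra.
Qed.

Lemma corner_eq K0 a b i : (forall k, (k <= i)%N -> vdig J j a k = vdig J j b k) ->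
  corner J j K0 a i = corner J j K0 b i.
Proof.
elim: i => //= i ih h; rewrite ih; last by move=> k hk; apply: h; lia.
by rewrite (h i.+1) // (h i).
Qed.

Lemma INR_depthS i : INR (depth J j i.+1) = INR (depth J j i) + INR (J i.+1) - INR (j i) - 1.
Proof.
rewrite [depth _ _ _]/= plus_INR !minus_INR; first by rewrite [INR 1]/=; ring.
- by have := lev i; lia.
- by have := lev i; lia.
Qed.

(** At the first level where the parameters differ, the corners are [n] grid steps apart: [y - x] is
    at least of order [n 2^-J] and [b - a] at most of order [n 2^-depth]. Writing
    [n = n^tau n^(1-tau)] and bounding the second factor by the number of intervals in one parent
    reduces the claim to [hC]. *)
Lemma holder_lt K0 tau C a b x y : 0 < tau <= 1 -> 
  (forall i, tau * INR (j i) <= INR (depth J j i) + C) ->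
  0 <= a < b -> b < 1 -> bracket K0 a x -> bracket K0 b y ->
  x < y /\ b - a <= Rpower 2 (C + 3) * Rpower (y - x) tau.
Proof.
move=> htau hC hab hb1 hx hy.
have [i [heq hlt]] := first_difference hab hb1.
set va := vdig J j a i.+1 in hlt *; set vb := vdig J j b i.+1 in hlt *.
pose n := (vb - va)%Z.
have hn1 : 1 <= IZR n by apply: IZR_le; rewrite /n; lia.
have hcor : corner J j K0 b i.+1 = (corner J j K0 a i.+1 + n)%Z.
  rewrite /= (corner_eq K0 heq) (heq i) // -/va -/vb /n; lia.
have hnM : IZR n <= 2 ^ (J i.+1 - j i - 1).
  rewrite -IZR_pow2; apply: IZR_le.
  have [a1 _] := digit_bounds a i; have [_ b2] := digit_bounds b i.
  by move: a1 b2; rewrite -/va -/vb (heq i) // /n; lia.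
have [l1 l2] := lev i; have [l3 _] := lev i.+1.
have p := pow2_gt0 (J i.+1).
(* [x] exceeds its corner by at most half a grid step, so the gap is at least [n - 1/2 >= n/2]
   steps. *)
have hyx : IZR n * Rpower 2 (- (INR (J i.+1) + 1)) <= y - x.
  have [_ h1] := hx i.+1; have [h2 _] := hy i.+1.
  rewrite hcor plus_IZR in h2.
  have h3 : / 2 ^ (j i.+1).+1 <= / 2 ^ (J i.+1).+1.
    by apply: Rinv_le_contravar; [exact: pow2_gt0 | apply: Rle_pow; [lra | lia]].
  have h4 : / 2 ^ (J i.+1).+1 = / 2 * / 2 ^ (J i.+1) by rewrite -tech_pow_Rmult; field; lra.
  have h5 : Rpower 2 (- (INR (J i.+1) + 1)) = / 2 * / 2 ^ (J i.+1).
    by rewrite Rpower_Ropp Rpower_plus Rpower2_nat Rpower_1; [field; lra | lra].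
  rewrite h5; have h6 := Rinv_0_lt_compat _ p.
  move: h2; rewrite /Rdiv Rmult_plus_distr_r; move: h1; rewrite /Rdiv => h1 h2.
  by nra.
have pJ := Rpower_gt0 2 (- (INR (J i.+1) + 1)).
have hpos : 0 < IZR n * Rpower 2 (- (INR (J i.+1) + 1)) by apply: Rmult_lt_0_compat; lra.
split; first by lra.
have hba : b - a <= 2 * IZR n * Rpower 2 (- INR (depth J j i.+1)).
  have h1 := Int_part_bounds (a * 2 ^ depth J j i.+1).
  have h2 := Int_part_bounds (b * 2 ^ depth J j i.+1).
  have en : IZR n = IZR vb - IZR va by rewrite /n minus_IZR.
  have q := pow2_gt0 (depth J j i.+1).
  rewrite Rpower_Ropp Rpower2_nat; apply: (Rmult_le_reg_r (2 ^ depth J j i.+1)) => //.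
  rewrite (Rmult_assoc (2 * IZR n)) Rinv_l; last by lra.
  by rewrite /va /vb /vdig in en; lra.
have hn : IZR n <= Rpower (IZR n) tau * Rpower 2 ((INR (J i.+1) - INR (j i) - 1) * (1 - tau)).
  rewrite -{1}(Rpower_1 (IZR n)); last by lra.
  have {1}-> : 1 = tau + (1 - tau) by ring.
  rewrite Rpower_plus; apply: Rmult_le_compat_l; first exact: Rlt_le (Rpower_gt0 _ _).
  rewrite -Rpower_mult; apply: Rle_Rpower_l; first by lra.
  split; first by lra.
  apply: Rle_trans hnM _; rewrite -Rpower2_nat; apply: Rpower2_le.
  by rewrite !minus_INR; [rewrite [INR 1]/=; lra | lia | lia].
have hyt : Rpower (IZR n) tau * Rpower 2 (- (INR (J i.+1) + 1) * tau) <= Rpower (y - x) tau.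
  rewrite -Rpower_mult Rpower_mult_distr; [|lra|lra].
  by apply: Rle_Rpower_l; lra.
have pn := Rpower_gt0 (IZR n) tau.
apply: (Rle_trans _ (Rpower 2 (C + 3) * (Rpower (IZR n) tau * Rpower 2 (- (INR (J i.+1) + 1) * tau)))); last first.
  by apply: Rmult_le_compat_l => //; exact: Rlt_le (Rpower_gt0 _ _).
apply: Rle_trans hba _.
have pd := Rpower_gt0 2 (- INR (depth J j i.+1)).
have h7 := Rmult_le_compat_r _ _ _ (Rlt_le _ _ pd) hn.
have -> : Rpower 2 (C + 3) * (Rpower (IZR n) tau * Rpower 2 (- (INR (J i.+1) + 1) * tau))
  = Rpower (IZR n) tau * Rpower 2 (C + 3 + - (INR (J i.+1) + 1) * tau) by rewrite [in RHS]Rpower_plus; ring.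
have h8 : 2 * (Rpower (IZR n) tau * Rpower 2 ((INR (J i.+1) - INR (j i) - 1) * (1 - tau)) *
    Rpower 2 (- INR (depth J j i.+1))) = Rpower (IZR n) tau *
    Rpower 2 (1 + ((INR (J i.+1) - INR (j i) - 1) * (1 - tau) + - INR (depth J j i.+1))).
  by rewrite !Rpower_plus Rpower_1; [ring | lra].
apply: (Rle_trans _ (2 * (Rpower (IZR n) tau * Rpower 2 ((INR (J i.+1) - INR (j i) - 1) * (1 - tau)) *
    Rpower 2 (- INR (depth J j i.+1))))); first by lra.
rewrite h8; apply: Rmult_le_compat_l; first by lra.
(* The exponents to compare leave [tau j - depth <= C] plus [1 + 2 tau], which is at most [3]. *)
by apply: Rpower2_le; rewrite INR_depthS; have := hC i; lra.
Qed.

End Digits.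

(** Since [n < J n], the increment makes the next [J] exceed [(i + 2) (j + 2)] for the current [j],
    so that the earlier levels are negligible at the next one. *)
Fixpoint level_index (j : nat -> nat) (b i : nat) : nat :=
  match i with
  | 0%N => (b + 2)%N
  | i'.+1 => (level_index j b i' + i'.+2 * (j (level_index j b i') + 2))%N
  end.

(** Level [0] is a dyadic cube of scale [b], used to localize the Cantor set; the given scales start
    at level [1]. *)
Definition shift_levels (J j : nat -> nat) (b i : nat) : nat :=
  match i with 0%N => b | i'.+1 => J (level_index j b i') end.

(** Each coordinate of [Phi a] comes from the one-dimensional construction with the same coordinate
    of [a] as parameter. By sparseness the depth is at least [(1 - kap) J] up to a constant, which
    gives the hypothesis of [holder_lt]. *)
Lemma cantor_set d (J j : nat -> nat) (x0 : Rd d) rho :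
  (forall n, (n < J n)%N /\ (J n <= j n)%N) -> 0 < rho ->
  exists Phi : Rd d -> Rd d,
    (forall a, edist x0 (Phi a) < rho /\
       forall n0, exists n (K : Zd d), (n0 <= n)%N /\
         forall m, IZR (K m) / 2 ^ J n <= Phi a m < IZR (K m) / 2 ^ J n + / 2 ^ j n) /\
    (forall tau kap B, 0 < tau <= 1 -> 0 < kap ->
       (forall n, tau * INR (j n) <= (1 - kap) * INR (J n) + B) ->
       exists C, 0 < C /\ forall (a b : Rd d) m, 0 <= a m <= / 2 -> 0 <= b m <= / 2 ->
         Rabs (a m - b m) <= C * rpow (Rabs (Phi a m - Phi b m)) tau).
Proof.
move=> hJ hrho.
have hd := INR_ge0 d.
(* Both [x0] and [Phi a] lie in one dyadic cube of scale [b], hence within [d 2^-b]; the [+ 1] keeps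
   the divisor positive when [d = 0]. *)
have [b hb] := @small_pow2 (rho / (INR d + 1)) ltac:(apply: Rdiv_lt_0_compat; lra).
pose nn := level_index j b.
pose Jl := shift_levels J j b; pose jl := shift_levels j j b.
have nnS i : nn i.+1 = (nn i + i.+2 * (j (nn i) + 2))%N by [].
have nn_ge i : (i <= nn i)%N.
  by elim: i => // i ih; rewrite nnS; nia.
have grow i : (i.+1 * (jl i + 2) <= Jl i.+1)%N.
  case: i => [|i]; first by have := hJ (nn 0%N); rewrite /Jl /jl /=; rewrite /nn /=; lia.
  have [h _] := hJ (nn i.+1).
  change (i.+2 * (j (nn i) + 2) <= J (nn i.+1))%N.
  by apply: leq_trans (ltnW h); rewrite nnS leq_addl.
have lev : cantor_levels Jl jl.
  move=> i; split; last by have := grow i; nia.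
  by case: i => [|i] //; case: (hJ (nn i)).
pose K0 (m : 'I_d) := Int_part (x0 m * 2 ^ b).
have [g hg] := choice_fun (P := fun ma : 'I_d * R => bracket Jl jl (K0 ma.1) ma.2)
   (fun ma => corner_limit lev (K0 ma.1) ma.2).
exists (fun a m => g (m, a m)); split.
  move=> a; split.
    have pb := pow2_gt0 b; have ib := Rinv_0_lt_compat _ pb.
    apply: (Rle_lt_trans _ (INR d * / 2 ^ b)).
      apply: edist_le; first by lra.
      move=> m; have := hg (m, a m) 0%N; rewrite /= /Jl /jl /=.
      have h1 := Int_part_bounds (x0 m * 2 ^ b); rewrite -/(K0 m) in h1.
      have e : / (2 * 2 ^ b) = / 2 * / 2 ^ b by field; lra.
      rewrite e => h2; apply: Rabs_le.
      have h3 : IZR (K0 m) / 2 ^ b <= x0 m.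
        by apply: (Rmult_le_reg_r (2 ^ b)) => //; rewrite /Rdiv Rmult_assoc Rinv_l; lra.
      have h4 : x0 m < IZR (K0 m) / 2 ^ b + / 2 ^ b.
        apply: (Rmult_lt_reg_r (2 ^ b)) => //; rewrite Rmult_plus_distr_r /Rdiv Rmult_assoc Rinv_l; lra.
      by lra.
    have hb' : (INR d + 1) * / 2 ^ b < rho.
      have := Rmult_lt_compat_l (INR d + 1) _ _ ltac:(lra) hb.
      by have -> : (INR d + 1) * (rho / (INR d + 1)) = rho by field; lra.
    by lra.
  move=> n0; exists (nn n0), (fun m => corner Jl jl (K0 m) (a m) n0.+1); split=> // m.
  have [h1 h2] := hg (m, a m) n0.+1; rewrite /= in h1 h2; split; first exact: h1.
  apply: Rle_lt_trans h2 _; apply: Rplus_lt_compat_l.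
  rewrite -/(pow 2 (jl n0.+1)).
  apply: Rinv_lt_contravar; last by have := pow2_gt0 (jl n0.+1); rewrite /jl /= -/(nn n0); lra.
  by apply: Rmult_lt_0_compat; [exact: pow2_gt0 | exact: (pow2_gt0 (jl n0.+1).+1)].
move=> tau kap B htau hkap hB.
have [I0 hI0] := nat_above (/ kap).
(* Beyond [I0], [kap J] is at least [j + 2] for the [j] of the preceding level; the finitely many
   levels up to [I0] are absorbed by their sum. *)
pose C := INR b + Rabs B + sum_f_R0 (fun i => INR (jl i)) I0.
have hC i : tau * INR (jl i) <= INR (depth Jl jl i) + C.
  have hB0 := Rabs_pos B; have hB1 := Rle_abs B; have hb0 := INR_ge0 b.
  have hs0 := cond_pos_sum (fun i => INR (jl i)) I0 (fun i => INR_ge0 _).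
  have hde := INR_ge0 (depth Jl jl i).
  have [hi|hi] : (i <= I0)%N \/ (I0 < i)%N by lia.
    have := sum_f_term (f := fun i => INR (jl i)) (fun i => INR_ge0 _) hi.
    have : tau * INR (jl i) <= INR (jl i) by have := INR_ge0 (jl i); nra.
    by rewrite /C; lra.
  case: i hi hde => // i hi hde.
  have h1 : tau * INR (jl i.+1) <= (1 - kap) * INR (Jl i.+1) + B by exact: (hB (nn i)).
  have h2 := INR_depthS lev i; have h3 := INR_ge0 (depth Jl jl i).
  have h4 := INR_leq (grow i); rewrite mult_INR plus_INR [INR 2]/= in h4.
  have h5 : 1 <= kap * INR i.+1.
    have h6 : / kap <= INR i.+1 by apply: Rle_trans hI0 _; apply: INR_leq; lia.
    by have := Rmult_le_compat_l _ _ _ (Rlt_le _ _ hkap) h6; rewrite Rinv_r; lra.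
  have h7 := Rmult_le_compat_l _ _ _ (Rlt_le _ _ hkap) h4.
  have h8 : INR (jl i) + 2 <= kap * INR i.+1 * (INR (jl i) + 2).
    by have := INR_ge0 (jl i); nra.
  by rewrite /C; lra.
exists (Rpower 2 (C + 3)); split; first exact: Rpower_gt0.
have main (a a' : R) m : 0 <= a < a' -> a' < 1 ->
   a' - a <= Rpower 2 (C + 3) * rpow (Rabs (g (m, a) - g (m, a'))) tau.
  move=> h1 h2; have [h3 h4] := holder_lt lev htau hC h1 h2 (hg (m, a)) (hg (m, a')).
  rewrite Rabs_left; last by lra.
  by rewrite rpow_pos; [rewrite Ropp_minus_distr | lra].
move=> a a' m h1 h2.
case: (Rtotal_order (a m) (a' m)) => [h|[h|h]].
- by rewrite Rabs_left; [have := main (a m) (a' m) m ltac:(lra) ltac:(lra); lra | lra].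
- rewrite h Rminus_diag Rabs_R0; apply: Rmult_le_pos; [exact: Rlt_le (Rpower_gt0 _ _) | exact: rpow_ge0].
rewrite Rabs_right; last by lra.
by rewrite (Rabs_minus_sym (g _)); exact: (main (a' m) (a m) m ltac:(lra) ltac:(lra)).
Qed.

Lemma cantor_avoid d (J j : nat -> nat) (x0 : Rd d) rho theta
    (P : nat -> Rd d -> Prop) (t : nat -> R) : (0 < d)%N ->
  (forall n, (n < J n)%N /\ (J n <= j n)%N) -> 0 < rho -> 0 < theta <= 1 ->
  (forall n, INR (j n) <= INR (J n) / theta + 1) ->
  (forall i, 0 < t i < INR d * theta) -> (forall i, hausdorff_null (t i) (P i)) ->
  exists x, edist x0 x < rho /\
    (forall n0, exists n (K : Zd d), (n0 <= n)%N /\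
       forall m, IZR (K m) / 2 ^ J n <= x m < IZR (K m) / 2 ^ J n + / 2 ^ j n) /\
    forall i, ~ P i x.
Proof.
move=> hd hJ hrho hth hj ht hP.
have hd1 : 1 <= INR d by apply: (INR_leq (m := 1)).
have [Phi [hPhi hH]] := cantor_set x0 hJ hrho.
apply: Classical_Prop.NNPP => hno.
have hcov (a : Rd d) : exists i, P i (Phi a).
  apply: Classical_Prop.NNPP => hne; apply: hno; exists (Phi a).
  have [h1 h2] := hPhi a; split=> //; split=> // i hi; apply: hne; by exists i.
apply: (cube_not_null hd).
apply: (hausdorff_null_mono (E := fun a => exists i, (forall m, 0 <= a m <= / 2) /\ P i (Phi a))).
  by move=> a ha; have [i hi] := hcov a; exists i.
apply: hausdorff_null_union => i eps heps.
have [t0 t1] := ht i.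
pose tau := t i / INR d.
have etau : tau * INR d = t i by rewrite /tau; field; lra.
have htau0 : 0 < tau by apply: Rdiv_lt_0_compat; lra.
have htau1 : tau < theta by apply: (Rmult_lt_reg_r (INR d)); lra.
(* [j <= J/theta + 1] gives [tau j <= (tau/theta) J + tau], hence [kap = 1 - tau/theta] and
   [B = tau]. *)
have [|||C [hC hol]] := hH tau (1 - tau / theta) tau.
- by lra.
- have : tau / theta < 1.
    apply: (Rmult_lt_reg_r theta); first by lra.
    by rewrite /Rdiv Rmult_assoc Rinv_l; lra.
  by lra.
- move=> n; have := Rmult_le_compat_l _ _ _ (Rlt_le _ _ htau0) (hj n).
  have -> : (1 - (1 - tau / theta)) * INR (J n) + tau = tau * (INR (J n) / theta + 1) by field; lra.
  by [].
pose q := Rpower (INR d * C) (INR d).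
have hq : 0 < q by exact: Rpower_gt0.
have [U [r [hr [hdiam [hU hsum]]]]] := hP i (eps / q) (Rdiv_lt_0_compat _ _ heps hq).
have hdC : 0 < INR d * C by apply: Rmult_lt_0_compat; lra.
exists (fun n a => (forall m, 0 <= a m <= / 2) /\ U n (Phi a)), (fun n => INR d * C * Rpower (r n) tau).
split; first by move=> n; apply: Rmult_lt_0_compat => //; exact: Rpower_gt0.
split.
  move=> n a b [ha hUa] [hb hUb]; rewrite Rmult_assoc.
  have pr := Rpower_gt0 (r n) tau.
  apply: edist_le; first by apply: Rmult_le_pos; lra.
  move=> m; apply: Rle_trans (hol a b m (ha m) (hb m)) _.
  apply: Rmult_le_compat_l; first by lra.
  rewrite -(rpow_pos tau (hr n)); apply: rpow_le => //.
  exact: Rle_trans (coord_le_edist _ _ m) (hdiam _ _ _ hUa hUb).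
split; first by move=> a [ha /hU [n hn]]; exists n.
move=> n.
have -> : sum_f_R0 (fun k => Rpower (INR d * C * Rpower (r k) tau) (INR d)) n
   = q * sum_f_R0 (fun k => Rpower (r k) (t i)) n.
  rewrite scal_sum; apply: PartSum.sum_eq => k _.
  rewrite -Rpower_mult_distr //; last exact: Rpower_gt0.
  by rewrite Rpower_mult etau /q Rmult_comm.
have := Rmult_le_compat_l _ _ _ (Rlt_le _ _ hq) (hsum n).
by have -> : q * (eps / q) = eps by field; lra.
Qed.

(** * Maximal divergence *)


Lemma inv_succ_lt e : 0 < e -> exists n : nat, / INR n.+1 < e.
Proof.
move=> he; have [n hn] := nat_above (/ e).
have ie := Rinv_0_lt_compat _ he.
exists n; rewrite -[e]Rinv_inv; apply: Rinv_lt_contravar.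
  by apply: Rmult_lt_0_compat => //; rewrite S_INR; lra.
by rewrite S_INR; lra.
Qed.

Lemma inv_succ_gt0 n : 0 < / INR n.+1.
Proof. by apply: Rinv_0_lt_compat; apply: (lt_INR 0); lia. Qed.

Section MaximalDivergence.
Variables (d N : nat) (psi : 'I_N -> Rd d -> Cpx) (s : R) (q : expo) (c : coefs d N).
Hypotheses (hd : (0 < d)%N) (hbdd : bounded_fun psi) (hq : expo_pos q).
Variables (L : list ('I_N * nat * Zd d)) (J : nat -> nat).
Hypothesis hcov : exists C0, 0 < C0 /\ forall x : Rd d, (forall m, 0 <= x m < 1) ->
  exists t, List.In t L /\ Cmod (wav psi t.1.1 t.1.2 t.2 x) >= C0.

Lemma lt_lub_rate x delta g : div_exp psi c x delta -> g < delta -> rate psi c x g.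
Proof.
rewrite div_expE => -[_ h] hg; apply: Classical_Prop.NNPP => hn.
have : delta <= g.
  apply: h => g' hg'; case: (Rlt_le_dec g g') => // hgg.
  by case: hn; apply: rate_le hg'; lra.
by lra.
Qed.

Lemma div_exp_bounds p x : expo_pos p -> in_b s p q c -> sat_scales s p L J c ->
  exists delta, div_exp psi c x delta /\ - s <= delta <= d_over d p - s.
Proof.
move=> hp hc hJ.
have hlow g : g < - s -> rate psi c x g.
  move=> hg; apply: (rate_approx hp hcov hJ (theta := 1)); [lra | exact: approx_by_one | lra].
have hup g : rate psi c x g -> g <= d_over d p - s by exact: rate_ub hp hq hbdd hc.
have [||delta hdelta] := completeness (rate psi c x).
- by exists (d_over d p - s) => g; exact: hup.
- by exists (- s - 1); apply: hlow; lra.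
exists delta; rewrite div_expE; split=> //; case: hdelta => h1 h2; split.
  case: (Rlt_le_dec delta (- s)) => // hlt.
  have := h1 ((delta + - s) / 2) ltac:(apply: hlow; lra); lra.
by apply: h2 => g; exact: hup.
Qed.

Variable r : R.
Hypotheses (hdec : fast_decay psi) (hr : 0 < r) (hc : in_b s (EFin r) q c)
  (hJ : sat_scales s (EFin r) L J c).

Let hp : expo_pos (EFin r) := hr.

(** An exponent other than [-s] is above [-s + 1/(n+1)] for some [n], and for that rate [rate_null]
    applies in every dimension above [d - r/(n+1)], in particular [d]. *)
Lemma div_exp_ae : lebesgue_null (fun x => True /\ ~ div_exp psi c x (- s)).
Proof.
have hd1 : 1 <= INR d by apply: (INR_leq (m := 1)).
apply: hausdorff_null_lebesgue => //.
apply: (hausdorff_null_mono (E := fun x => exists n : nat, rate psi c x (- s + / INR n.+1))).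
  move=> x [_ hx]; have [delta [h1 [h2 h3]]] := div_exp_bounds x hp hc hJ.
  have [e|hlt] : delta = - s \/ - s < delta by lra.
    by case: hx; rewrite -e.
  have [n hn] := @inv_succ_lt (delta + s) ltac:(lra).
  by exists n; apply: lt_lub_rate h1 _; lra.
apply: hausdorff_null_union => n; apply: rate_null hc _ _ => //; first by lra.
by have := inv_succ_gt0 n; nra.
Qed.

Section Level.
Variables (B : Rd d -> Prop) (x0 : Rd d) (rho g : R).
Hypotheses (hrho : 0 < rho) (hB : forall y, edist x0 y < rho -> B y)
  (hg : - s <= g <= INR d / r - s).

Let a := INR d - s * r - g * r.

Lemma dim_range : 0 <= a <= INR d.
Proof.
have [h1 h2] := hg; have e : INR d / r * r = INR d by field; lra.
have h3 := Rmult_le_compat_r _ _ _ (Rlt_le _ _ hr) h1.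
have h4 := Rmult_le_compat_r _ _ _ (Rlt_le _ _ hr) h2.
by rewrite /a; lra.
Qed.

Lemma approx_rate x g' : approx_by J (a / INR d) x -> g' < g -> rate psi c x g'.
Proof.
have hd1 : 1 <= INR d by apply: (INR_leq (m := 1)).
have [h1 h2] := dim_range.
move=> hx hg'; apply: (rate_approx hp hcov hJ (theta := a / INR d)) => //.
  split; first by apply: Rmult_le_pos => //; apply: Rlt_le; apply: Rinv_0_lt_compat; lra.
  apply: (Rmult_le_reg_r (INR d)); first by lra.
  by rewrite /Rdiv Rmult_assoc Rinv_l; lra.
rewrite /=; have -> : INR d / r - s - INR d / r * (a / INR d) = g by rewrite /a; field; lra.
by [].
Qed.

(** Scales [j] close to [J / theta] give every point of the Cantor set an exponent of at least [g].
    Larger exponents are excluded by avoiding the sets of rate [g + 1/(i+1)], together with [E]. *)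
Lemma level_set_avoid E t : 0 < t < a -> hausdorff_null t E ->
  exists x, B x /\ div_exp psi c x g /\ ~ E x.
Proof.
have hd1 : 1 <= INR d by apply: (INR_leq (m := 1)).
have [h1 h2] := dim_range.
move=> ht hE; set theta := a / INR d.
have eth : INR d * theta = a by rewrite /theta; field; lra.
have hth : 0 < theta <= 1 by split; apply: (Rmult_lt_reg_l (INR d)) || apply: (Rmult_le_reg_l (INR d)); lra.
have hth1 : 1 <= / theta by rewrite -[1]Rinv_1; apply: Rinv_le_contravar; lra.
have [j hj] : exists j : nat -> nat, forall n, INR (J n) / theta <= INR (j n) <= INR (J n) / theta + 1.
  apply: (choice_fun (P := fun n jn => INR (J n) / theta <= INR jn <= INR (J n) / theta + 1)) => n.
  by apply: nat_ceil; apply: Rmult_le_pos; [exact: INR_ge0 | lra].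
have hJj n : (n < J n)%N /\ (J n <= j n)%N.
  have [hn _] := hJ n; split=> //; apply/leP; apply: INR_le.
  apply: Rle_trans (proj1 (hj n)); rewrite -{1}[INR (J n)]Rmult_1_r.
  by apply: Rmult_le_compat_l => //; exact: INR_ge0.
pose P i x := match i with 0%N => E x | i'.+1 => rate psi c x (g + / INR i'.+1) end.
(* [a - r/(2 (i+1))] lies strictly between [a - r/(i+1)], the bound in [rate_null], and [a]; the
   maximum with [a / 2] keeps it positive. *)
pose ts i := match i with 0%N => t | i'.+1 => Rmax (a / 2) (a - r * / INR i'.+1 / 2) end.
have hts i : 0 < ts i < INR d * theta.
  rewrite eth; case: i => [|i] //=; rewrite -/(INR i.+1).
  have hi := Rmult_lt_0_compat _ _ hr (inv_succ_gt0 i).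
  split; first by apply: Rlt_le_trans (Rmax_l _ _); lra.
  by apply: Rmax_lub_lt; lra.
have hP i : hausdorff_null (ts i) (P i).
  have := hts i; case: i => [|i] // [hti _].
  apply: rate_null hc _ _ => //.
  apply: Rlt_le_trans (Rmax_r _ _).
  have hi := Rmult_lt_0_compat _ _ hr (inv_succ_gt0 i).
  by rewrite /a; lra.
have [x [hx1 [hx2 hx3]]] := cantor_avoid x0 hd hJj hrho hth (fun n => proj2 (hj n)) hts hP.
exists x; split; first exact: hB; split; last exact: (hx3 0%N).
have happ : approx_by J theta x.
  (* [n1] ensures [j n <= (n+1) J n], because [J n >= 1] gives [j n <= (1/theta + 1) J n]. *)
  move=> n0; have [n1 hn1] := nat_above (/ theta + 1).
  have [n [K [hn hK]]] := hx2 (n0 + n1)%N.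
  have [hn2 hn3] := hJj n; have [hn4 hn5] := hj n.
  exists n, (j n), K; split; first by lia.
  split=> //; split; last split=> //.
    apply/leP; apply: INR_le; rewrite mult_INR; apply: Rle_trans hn5 _.
    have hJ1 : 1 <= INR (J n) by apply: (INR_leq (m := 1)); lia.
    have hnn : / theta + 1 <= INR n.+1 by apply: Rle_trans hn1 _; apply: INR_leq; lia.
    have := Rmult_le_compat_r (INR (J n)) _ _ ltac:(lra) hnn.
    by rewrite /Rdiv; lra.
  have -> : INR (J n) = theta * (INR (J n) / theta) by field; lra.
  apply: (Rle_trans _ (theta * INR (j n))); first by apply: Rmult_le_compat_l; lra.
  apply: Rmult_le_compat_r; first exact: INR_ge0.
  by have := inv_succ_gt0 n; lra.
have [delta [hdl _]] := div_exp_bounds x hp hc hJ.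
have [hlt|[<-|hgt]] := Rtotal_order delta g; last 2 first.
- by [].
- have [n hn] := @inv_succ_lt (delta - g) ltac:(lra).
  by case: (hx3 n.+1); apply: lt_lub_rate hdl _; lra.
have := approx_rate happ (g' := (delta + g) / 2) ltac:(lra).
by case: hdl => hub _ /hub; lra.
Qed.

Lemma level_set_dim : dimH_eq (fun x => B x /\ div_exp psi c x g) a.
Proof.
have hd1 : 1 <= INR d by apply: (INR_leq (m := 1)).
have [h1 h2] := dim_range.
split; last split.
- have [ha|ha] : 0 < a \/ a = 0 by lra.
    (* For nonemptiness when [a > 0], any set null in a dimension below [a] can serve as the set to
       avoid. *)
    have hti : 0 < Rmax (a / 2) (a - r / 2) < a.
      by split; [apply: Rlt_le_trans (Rmax_l _ _) | apply: Rmax_lub_lt]; lra.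
    have [|x [hx1 [hx2 _]]] := level_set_avoid (E := fun x => rate psi c x (g + 1)) hti.
      by apply: rate_null hc _ _ => //; [lra | apply: Rlt_le_trans (Rmax_r _ _); rewrite /a; lra].
    by exists x.
  (* For [a = 0] the scales [j = (n+1) J] give approximation with [theta = 0], hence the maximal
     exponent [d/r - s], which then equals [g]. *)
  have [|Phi [hPhi _]] := @cantor_set d J (fun n => n.+1 * J n)%N x0 rho _ hrho.
    by move=> n; have [hn _] := hJ n; split=> //; rewrite leq_pmull.
  have [hx1 hx2] := hPhi x0; exists (Phi x0); split; first exact: hB.
  have happ : approx_by J (a / INR d) (Phi x0).
    move=> n0; have [n [K [hn hK]]] := hx2 n0.
    exists n, (n.+1 * J n)%N, K; split=> //; split; first by rewrite leq_pmull.
    split=> //; split=> //; rewrite ha mult_INR.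
    have : INR n.+1 <> 0 by apply: Rgt_not_eq; apply: (lt_INR 0); lia.
    by move=> hne; apply: Req_le; field; lra.
  have [delta [hdl [_ hdl2]]] := div_exp_bounds (Phi x0) hp hc hJ.
  have eg : g = INR d / r - s.
    have e : INR d / r * r = INR d by field; lra.
    by apply: (Rmult_eq_reg_r r); [rewrite Rmult_minus_distr_r e; move: ha; rewrite /a; lra | lra].
  suff -> : g = delta by [].
  rewrite /= -eg in hdl2; apply: Rle_antisym => //.
  case: (Rlt_le_dec delta g) => // hlt.
  have := approx_rate happ (g' := (delta + g) / 2) ltac:(lra).
  by case: hdl => hub _ /hub; lra.
- move=> t hat.
  pose g' := g - (t - a) / (2 * r).
  have hg' : g' < g.
    by rewrite /g'; have : 0 < (t - a) / (2 * r); [apply: Rdiv_lt_0_compat; lra | lra].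
  apply: (hausdorff_null_mono (E := fun x => rate psi c x g')).
    by move=> x [_ hx]; exact: lt_lub_rate hx _.
  apply: rate_null hc _ _ => //; first by lra.
  have -> : INR d - s * r - g' * r = a + (t - a) / 2 by rewrite /g' /a; field; lra.
  by lra.
(* The level set itself is taken as the set to avoid. *)
move=> t ht0 hta hnull.
have [x [hx1 [hx2 hx3]]] := level_set_avoid (conj ht0 hta) hnull.
exact: hx3.
Qed.

End Level.

End MaximalDivergence.

Unset Implicit Arguments.

Theorem mainTheorem12 (d N : nat) (hd : (1 <= d)%nat) (hN : (1 <= N)%nat)
  (psi : 'I_N -> Rd d -> Cpx)
  (hbdd : bounded_fun psi) (hdec : fast_decay psi)
  (s : R) (p q : expo) (hp : expo_pos p) (hq : expo_pos q)
  (hcov : dyadic_covering psi) :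
  b_residual s p q (fun c : coefs d N => max_div psi s p c (fun _ => True)).
Proof.
have [C0 [hC0 [L [_ hL]]]] := hcov.
have hLC : exists C0, 0 < C0 /\ forall x : Rd d, (forall m, 0 <= x m < 1) ->
    exists t, List.In t L /\ Cmod (wav psi t.1.1 t.1.2 t.2 x) >= C0 by exists C0.
(* Orders start at [1] because density is proved for [0 < n]. *)
exists (fun n => saturated s p L n.+1); split.
  by move=> n; split; [exact: saturated_open | exact: saturated_dense].
move=> c hc /saturated_scales [J hJ].
move: hp hc hJ; case: p => [r|] hr hc hJ /=; last first.
  (* For infinite [p] the term [d/p] is [0], so both bounds on the exponent equal [-s]. *)
  move=> x _; have [delta [h1 [h2 h3]]] := div_exp_bounds hbdd hq hLC x hr hc hJ.
  by have <- : delta = - s by rewrite /= in h3; lra.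
split; first by move=> x _; exact: (div_exp_bounds hbdd hq hLC x hr hc hJ).
split; first exact: (div_exp_ae hd hbdd hq hLC hdec hr hc hJ).
move=> B hB [x0 hx0] _ g hg.
have [rho [hrho hball]] := hB x0 hx0.
exact: (level_set_dim hd hbdd hq hLC hdec hr hc hJ hrho hball hg).
Qed.
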